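(* The maps between $2$- and $3$-dimensional Bott--Samelson cells corresponding to tetravalent and hexavalent vertices are Poisson isomorphisms. That is: if $i,k\in I$ are non-adjacent, then $$\mathcal{O}^{(i,k)}\to\mathcal{O}^{(k,i)},\qquad \Phi_{(i,k)}(z_1,z_2)\mapsto\Phi_{(k,i)}(z_2,z_1)$$ is a Poisson isomorphism, and if $i,j\in I$ are adjacent, then $$\mathcal{O}^{(i,j,i)}\to\mathcal{O}^{(j,i,j)},\qquad \Phi_{(i,j,i)}(z_1,z_2,z_3)\mapsto\Phi_{(j,i,j)}(z_3,z_1z_3-z_2,z_1)$$ is a Poisson isomorphism.
   Context: $G$ is a simple complex algebraic group of simply-laced type with opposite Borel subgroups $B,B^-$, simple roots $\alpha_i$ ($i\in I$), Cartan matrix $(a_{ij})$; distinct $i,j$ are adjacent if $a_{ij}=a_{ji}=-1$ and non-adjacent if $a_{ij}=a_{ji}=0$. $P_i=B\sqcup Bs_iB$. A pinning gives $\varphi_i:SL_2\to G$; $B_i(z)=\varphi_i\begin{pmatrix}1&z\\0&1\end{pmatrix}\varphi_i\begin{pmatrix}0&-1\\1&0\end{pmatrix}$. For a word $\underline{w}=(i_1,\dots,i_\ell)$, $Z_{\underline{w}}=(P_{i_1}\times\cdots\times P_{i_\ell})/B^\ell$ with $(g_1,\dots,g_\ell)*(b_1,\dots,b_\ell)=(g_1b_1,b_1^{-1}g_2b_2,\dots,b_{\ell-1}^{-1}g_\ell b_\ell)$. The Bott--Samelson cell $\mathcal{O}^{\underline{w}}\subset Z_{\underline{w}}$ is the image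 of the open embedding $\Phi_{\underline{w}}:\mathbb{A}^\ell\to Z_{\underline{w}}$, $\Phi_{\underline{w}}(z_1,\dots,z_\ell)=[B_{i_1}(z_1),\dots,B_{i_\ell}(z_\ell)]$. Standard Poisson structure. With the invariant form normalised by $\langle\alpha,\alpha\rangle=2$ on short roots and $\Lambda=\sum_{\alpha>0}\frac{\langle\alpha,\alpha\rangle}{2}e_{-\alpha}\wedge e_{\alpha}$, $[e_\alpha,e_{-\alpha}]=\alpha^\vee$, put $\pi_{\mathrm{st}}(g)=(l_g)_*\Lambda-(r_g)_*\Lambda$ on $G$. The $P_i$ are Poisson subgroups; the product structure on $P_{i_1}\times\cdots\times P_{i_\ell}$ pushes forward to the standard Poisson structure on $Z_{\underline{w}}$, which is restricted to $\mathcal{O}^{\underline{w}}$. *)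

(* Defs.v *)
From mathcomp Require Export all_boot all_order all_algebra.
From mathcomp Require Export classical_sets functions reals.
From mathcomp Require Export complex mpoly.

Set Implicit Arguments.
Unset Strict Implicit.
Unset Printing Implicit Defensive.

Import Order.TTheory GRing.Theory Num.Theory.
Local Open Scope ring_scope.
Local Open Scope classical_set_scope.

(** * Linear algebraic groups: Zariski closed subgroups of GL_n(C) *)

Section LinearAlgebraicGroups.
Variables (C : numClosedFieldType) (n : nat).
Implicit Types (f : {mpoly C[n * n]}) (g h x y t : 'M[C]_n).
Implicit Types X Y H N G T B : set 'M[C]_n.

(* A polynomial in the n * n matrix entries, ordered as in [mxvec], and its
   differential at g applied to the tangent vector x. *)
Definition mxeval f g : C := f.@[fun k => mxvec g 0 k].

Definition mxdiff f g x : C :=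
  \sum_(k < n * n) (f^`M(k)).@[fun k' => mxvec g 0 k'] * mxvec x 0 k.

(* Closed in GL_n. Polynomials without 1 / det suffice, since det is
   invertible on GL_n. *)
Definition zariski_closed X : Prop :=
  exists S : set {mpoly C[n * n]},
    X = [set g | g \in unitmx /\ forall f, S f -> mxeval f g = 0].

Definition is_subgroup H : Prop :=
  [/\ forall g, H g -> g \in unitmx,
      H 1%:M,
      forall g h, H g -> H h -> H (g *m h)
    & forall g, H g -> H (invmx g)].

Definition is_alg_group H : Prop := is_subgroup H /\ zariski_closed H.

Definition zariski_connected X : Prop :=
  forall Y Y', zariski_closed Y -> zariski_closed Y' ->
    X `<=` Y `|` Y' -> X `&` Y `&` Y' = set0 ->
    X `&` Y = set0 \/ X `&` Y' = set0.

Definition lie_bracket x y : 'M[C]_n := x *m y - y *m x.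

Definition adj g x : 'M[C]_n := g *m x *m invmx g.

(* Tangent space at the identity. *)
Definition lie_alg H : set 'M[C]_n :=
  [set x | forall f, (forall g, H g -> mxeval f g = 0) -> mxdiff f 1%:M x = 0].

Definition is_normal_in N G : Prop :=
  N `<=` G /\ forall g h, G g -> N h -> N (adj g h).

(* "Simple" in the sense of algebraic groups: the centre may be finite and
   nontrivial. *)
Definition is_simple_alg_group G : Prop :=
  [/\ is_alg_group G, zariski_connected G,
      exists g h, [/\ G g, G h & g *m h <> h *m g]
    & forall N, is_alg_group N -> zariski_connected N -> is_normal_in N G ->
        N = [set 1%:M] \/ N = G].

Definition generated X : set 'M[C]_n :=
  [set g | forall H, is_subgroup H -> X `<=` H -> H g].

Definition derived_subgroup H : set 'M[C]_n :=
  generated [set c | exists g h,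
    [/\ H g, H h & c = g *m h *m invmx g *m invmx h]].

Definition is_solvable H : Prop :=
  exists m, iter m derived_subgroup H = [set 1%:M].

Definition is_conn_solvable_in G B : Prop :=
  [/\ is_alg_group B, B `<=` G, zariski_connected B & is_solvable B].

Definition is_borel G B : Prop :=
  is_conn_solvable_in G B /\
  forall B', is_conn_solvable_in G B' -> B `<=` B' -> B' = B.

Definition is_torus_in G T : Prop :=
  [/\ is_alg_group T, T `<=` G, zariski_connected T
    & exists2 u : 'M[C]_n, u \in unitmx & forall t, T t -> is_diag_mx (adj u t)].

Definition is_max_torus G T : Prop :=
  is_torus_in G T /\ forall T', is_torus_in G T' -> T `<=` T' -> T' = T.

Definition opposite_borels G B B' : Prop :=
  [/\ is_borel G B, is_borel G B' & is_max_torus G (B `&` B')].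

(** ** Roots *)

(* A character of T is given by a function on all matrices of which only the
   values on T matter; [eq_char] is the resulting equality. *)
Implicit Types chi : 'M[C]_n -> C.

Definition eq_char T chi chi' : Prop := forall t, T t -> chi t = chi' t.

Definition inv_char chi : 'M[C]_n -> C := fun t => (chi t)^-1.

Definition weight_space G T chi : set 'M[C]_n :=
  [set x | lie_alg G x /\ forall t, T t -> adj t x = chi t *: x].

(* The existence of a weight vector forces chi to be a character on T. *)
Definition is_root G T chi : Prop :=
  (exists2 t, T t & chi t <> 1) /\
  (exists2 x, x <> 0 & weight_space G T chi x).

(* The roots of B, i.e. the positive roots. *)
Definition is_pos_root G B T chi : Prop :=
  is_root G T chi /\ weight_space G T chi `<=` lie_alg B.

(* alpha is the base of the root system whose positive roots are those of B.
   The character group is written multiplicatively. *)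
Definition is_simple_roots (I : finType) G B T
    (alpha : I -> 'M[C]_n -> C) : Prop :=
  let comb (c : I -> int) t := \prod_i alpha i t ^ c i in
  [/\ forall i, is_pos_root G B T (alpha i),
      forall c, eq_char T (comb c) (fun=> 1) -> forall i, c i = 0
    & forall chi, is_root G T chi ->
        exists2 c, eq_char T chi (comb c) &
          (is_pos_root G B T chi /\ forall i, 0 <= c i) \/
          (~ is_pos_root G B T chi /\ forall i, c i <= 0)].

(* h, in Lie T, is the coroot of chi: it lies in [g_chi, g_{-chi}] and
   d chi (h) = 2. *)
Definition is_coroot G T chi h : Prop :=
  [/\ lie_alg T h,
      exists x y, [/\ weight_space G T chi x,
                      weight_space G T (inv_char chi) y
                    & h = lie_bracket x y]
    & forall x, weight_space G T chi x -> lie_bracket h x = 2 *: x].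

Definition is_invariant_form G (kappa : 'M[C]_n -> 'M[C]_n -> C) : Prop :=
  let L := lie_alg G in
  [/\ forall a x y z, L x -> L y -> L z ->
        kappa (a *: x + y) z = a * kappa x z + kappa y z,
      forall x y, L x -> L y -> kappa x y = kappa y x,
      forall g x y, G g -> L x -> L y -> kappa (adj g x) (adj g y) = kappa x y
    & forall x, L x -> (forall y, L y -> kappa x y = 0) -> x = 0].

(* t represents d chi in Lie T via kappa: d chi (h) = kappa t h. *)
Definition form_dual G T kappa chi (t : 'M[C]_n) : Prop :=
  lie_alg T t /\
  forall h x, lie_alg T h -> weight_space G T chi x ->
    lie_bracket h x = (kappa t h : C) *: x.

End LinearAlgebraicGroups.

(** * Pinned simple groups of simply-laced type *)

Section PinnedGroups.
Variable C : numClosedFieldType.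

Definition mx2 (a b c d : C) : 'M[C]_2 :=
  \matrix_(r < 2, s < 2)
    (if r == 0 then if s == 0 then a else b else if s == 0 then c else d).

Definition mxU (z : C) := mx2 1 z 0 1.
Definition mxL (z : C) := mx2 1 0 z 1.
Definition mxD (a : C) := mx2 a 0 0 a^-1.
Definition mxS := mx2 0 (-1) 1 0.

Record group_data (I : finType) (n : nat) := GroupData {
  gr : set 'M[C]_n;
  bor : set 'M[C]_n;
  borm : set 'M[C]_n;
  sroot : I -> 'M[C]_n -> C;
  cartan : I -> I -> int;
  (* The homomorphisms phi_i : SL_2 -> G, as matrices of polynomials in the
     four entries of an element of SL_2. *)
  pin : I -> 'M[{mpoly C[2 * 2]}]_n;
  (* The positive roots and, for each positive root alpha, the vectors
     e_alpha and e_{-alpha}. *)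
  npos : nat;
  proot : 'I_npos -> 'M[C]_n -> C;
  evec : 'I_npos -> 'M[C]_n;
  fvec : 'I_npos -> 'M[C]_n;
  (* The invariant form, and the elements of Lie T that represent the positive
     roots with respect to it. *)
  form : 'M[C]_n -> 'M[C]_n -> C;
  tvec : 'I_npos -> 'M[C]_n }.

Variables (I : finType) (n : nat) (D : group_data I n).
Implicit Types (i j : I) (a : 'I_(npos D)).

Definition tor : set 'M[C]_n := bor D `&` borm D.

Definition phi i (g : 'M[C]_2) : 'M[C]_n :=
  map_mx (fun f => mxeval f g) (pin D i).

Definition dphi i (g v : 'M[C]_2) : 'M[C]_n :=
  map_mx (fun f => mxdiff f g v) (pin D i).

Definition is_pinning : Prop := forall i,
  [/\ forall g, \det g = 1 -> gr D (phi i g),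
      phi i 1%:M = 1%:M
      /\ (forall g h, \det g = 1 -> \det h = 1 ->
            phi i (g *m h) = phi i g *m phi i h),
      forall t : C, t != 0 -> tor (phi i (mxD t)),
      injective (fun z => phi i (mxU z))
    & forall t z, tor t ->
        adj t (phi i (mxU z)) = phi i (mxU (sroot D i t * z)) /\
        adj t (phi i (mxL z)) = phi i (mxL ((sroot D i t)^-1 * z))].

(* a_ij is the pairing of the coroot t |-> phi_i (diag (t, t^-1)) with
   alpha_j. *)
Definition is_cartan_matrix : Prop :=
  forall i j (t : C), t != 0 -> sroot D j (phi i (mxD t)) = t ^ cartan D i j.

Definition adjacent i j : Prop :=
  [/\ i <> j, cartan D i j = -1 & cartan D j i = -1].

Definition non_adjacent i j : Prop :=
  [/\ i <> j, cartan D i j = 0 & cartan D j i = 0].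

Definition simply_laced : Prop :=
  forall i j, i <> j -> adjacent i j \/ non_adjacent i j.

(* e_alpha and e_{-alpha} span the root spaces (which are lines), and
   [e_alpha, e_{-alpha}] is the coroot of alpha. *)
Definition is_root_vectors : Prop :=
  [/\ forall a, is_pos_root (gr D) (bor D) tor (proot a),
      forall chi, is_pos_root (gr D) (bor D) tor chi ->
        exists a, eq_char tor chi (proot a),
      forall a a', eq_char tor (proot a) (proot a') -> a = a',
      forall a, weight_space (gr D) tor (proot a) = range (fun c => c *: evec a)
             /\ weight_space (gr D) tor (inv_char (proot a))
                = range (fun c => c *: fvec a)
    & forall a, is_coroot (gr D) tor (proot a) (lie_bracket (evec a) (fvec a))].

(* <alpha, alpha>, for the form induced on the dual of Lie T. *)
Definition sqlen a : C := form D (tvec a) (tvec a).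

Definition is_short a : Prop := forall a', `|sqlen a| <= `|sqlen a'|.

Definition is_normalized_form : Prop :=
  [/\ is_invariant_form (gr D) (form D),
      forall a, form_dual (gr D) tor (form D) (proot a) (tvec a)
    & forall a, is_short a -> sqlen a = 2].

Definition is_pinned_simply_laced_group : Prop :=
  [/\ is_simple_alg_group (gr D),
      opposite_borels (gr D) (bor D) (borm D),
      is_simple_roots (gr D) (bor D) tor (sroot D),
      is_cartan_matrix /\ simply_laced
    & [/\ is_pinning, is_root_vectors & is_normalized_form]].

(** * Bott-Samelson varieties and cells *)

Definition weyl_rep i : 'M[C]_n := phi i mxS.

Definition parabolic i : set 'M[C]_n :=
  bor D `|` [set g | exists x y,
    [/\ bor D x, bor D y & g = x *m weyl_rep i *m y]].

Definition braid_mx i (z : C) : 'M[C]_n := phi i (mxU z) *m weyl_rep i.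

(* The derivative of braid_mx i with respect to z. *)
Definition dbraid_mx i (z : C) : 'M[C]_n :=
  dphi i (mxU z) (delta_mx 0 1) *m weyl_rep i.

Section Words.
Variables (l : nat) (w : l.-tuple I).

(* Points, and tangent vectors, of the product of l copies of GL_n. *)
Notation point := ('I_l -> 'M[C]_n).
Implicit Types (p b x xi eta v : point) (z : l.-tuple C) (k : 'I_l).

Definition in_parabolics p : Prop := forall k, parabolic (tnth w k) (p k).

Definition in_borels b : Prop := forall k, bor D (b k).

(* b_{k-1}, with the convention that there is d before the first entry. *)
Definition prev (d : 'M[C]_n) b k : 'M[C]_n :=
  if val k == 0%N then d else b (ord_pred k).

Definition bs_act p b : point :=
  fun k => invmx (prev 1%:M b k) *m p k *m b k.

(* Elements of the Bott-Samelson variety are B^l-orbits. *)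
Definition bs_class p : set point :=
  [set q | exists2 b, in_borels b & q = bs_act p b].

Definition bs_variety : set (set point) := bs_class @` in_parabolics.

Definition braid_point z : point := fun k => braid_mx (tnth w k) (tnth z k).

Definition Phi z : set point := bs_class (braid_point z).

Definition bs_cell : set (set point) := range Phi.

(** ** The standard Poisson structure *)

(* A covector on the product of the matrix spaces is given by a family of
   matrices through the trace pairing. *)
Definition pairing xi v : C := \sum_k \tr (xi k *m v k).

(* Lambda = sum over alpha > 0 of <alpha, alpha> / 2 e_{-alpha} /\ e_alpha, and
   pi_st(g) = (l_g)_* Lambda - (r_g)_* Lambda, as bilinear forms on covectors;
   x /\ y is x (x) y - y (x) x. *)
Definition wedge (x y : 'M[C]_n) (xi eta : 'M[C]_n) : C :=
  \tr (xi *m x) * \tr (eta *m y) - \tr (xi *m y) * \tr (eta *m x).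

Definition pi_st (g : 'M[C]_n) (xi eta : 'M[C]_n) : C :=
  \sum_a sqlen a / 2 *
    (wedge (g *m fvec a) (g *m evec a) xi eta
     - wedge (fvec a *m g) (evec a *m g) xi eta).

Definition pi_prod p xi eta : C := \sum_k pi_st (p k) (xi k) (eta k).

(* The tangent vector at p to the orbit of p, in the direction of x in
   (Lie B)^l: the derivative of bs_act p at the identity. *)
Definition orbit_tangent p x : point :=
  fun k => p k *m x k - prev 0 x k *m p k.

(* The conormal covectors to the orbit of p, which are the pullbacks to p of
   the cotangent vectors of the Bott-Samelson variety at bs_class p. *)
Definition conormal p xi : Prop :=
  forall x, (forall k, lie_alg (bor D) (x k)) ->
    pairing xi (orbit_tangent p x) = 0.

(* The partial derivative of z |-> bs_act (braid_point z) b with respect to the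
   k-th coordinate of z; this map lifts Phi, and bs_act is linear in its first
   argument. *)
Definition lift_diff z b k : point :=
  bs_act (fun k' => if k' == k then dbraid_mx (tnth w k) (tnth z k) else 0) b.

(* The bivector field P on the cell, given in the coordinates z by the matrix of
   the brackets {z_k, z_m}, is the push-forward of pi_prod. The points of the
   product of the P_i above Phi z are the bs_act (braid_point z) b, and at each
   of them, for all cotangent vectors xi and eta at Phi z, the value of P on
   xi and eta is that of pi_prod on their pullbacks. *)
Definition is_standard_poisson (P : l.-tuple C -> 'M[C]_l) : Prop :=
  (forall z, (P z)^T = - P z) /\
  forall z b, in_borels b ->
    let p := bs_act (braid_point z) b in
    forall xi eta, conormal p xi -> conormal p eta ->
      \sum_k \sum_m P z k m * pairing xi (lift_diff z b k)
                            * pairing eta (lift_diff z b m)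
      = pi_prod p xi eta.

End Words.

(** ** Morphisms of cells *)

Definition poly_map (l l' : nat) (F : l'.-tuple {mpoly C[l]})
    (z : l.-tuple C) : l'.-tuple C :=
  [tuple (tnth F k).@[tnth z] | k < l'].

Definition jacobian (l l' : nat) (F : l'.-tuple {mpoly C[l]})
    (z : l.-tuple C) : 'M[C]_(l', l) :=
  \matrix_(k < l', m < l) ((tnth F k)^`M(m)).@[tnth z].

(* Since Phi is an isomorphism from the affine space to the cell, psi and its
   inverse are regular if and only if they are polynomial in the coordinates. *)
Definition is_poisson_iso (l l' : nat) (w : l.-tuple I) (w' : l'.-tuple I)
    (P : l.-tuple C -> 'M[C]_l) (P' : l'.-tuple C -> 'M[C]_l')
    (psi : set ('I_l -> 'M[C]_n) -> set ('I_l' -> 'M[C]_n)) : Prop :=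
  set_bij (bs_cell w) (bs_cell w') psi /\
  exists (F : l'.-tuple {mpoly C[l]}) (F' : l.-tuple {mpoly C[l']}),
    [/\ forall z, psi (Phi w z) = Phi w' (poly_map F z),
        forall z', psi (Phi w (poly_map F' z')) = Phi w' z'
      & forall z, jacobian F z *m P z *m (jacobian F z)^T = P' (poly_map F z)].

End PinnedGroups.

(* Main.v *)
(* The bivector pi_st is multiplicative, so the multiplication map sends the
   standard Poisson structure of a cell to that of G / B, and both sides of
   each map have the same image there: in the adjacent case by
     B_i(z1) B_j(z2) B_i(z3) = B_j(z3) B_i(z1 z3 - z2) B_j(z1),
   in the non-adjacent case because B_i(z1) and B_k(z2) commute. The words being
   reduced, multiplication is an immersion of the cell into G / B (its partial
   derivatives span, modulo Lie B, the root spaces of negative roots, one for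
   each letter), so a bivector on the cell is determined by its image.

   The relations between root subgroups come from weights: a weight vector of
   weight p alpha_i + q alpha_j with p q < 0 vanishes, and Ad(s_i) reflects
   weights. *)
From mathcomp Require Import boolp ring.
Require Import Defs.

Set Implicit Arguments.
Unset Strict Implicit.
Unset Printing Implicit Defensive.

Import Order.TTheory GRing.Theory Num.Theory.
Local Open Scope ring_scope.
Local Open Scope classical_set_scope.

(** Root subgroups are treated as polynomial homomorphisms from the additive group. In
    characteristic 0 such a homomorphism is determined by its derivative at 0, so formal
    differentiation of matrices of polynomials reduces identities between root subgroups to
    identities between brackets. A Lie algebra is here a subspace cut out by linear forms: a
    polynomial curve inside it has its velocities inside it, which yields closure under brackets
    with E_i and F_i. Independence modulo Lie B is tested with the single torus element h_i(2),
    whose eigenvalues on the negative root spaces in question are distinct powers of 2. Since Lie B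
    is the annihilator of its annihilator, the covectors that kill it are numerous enough to recover
    a bivector on the cell from its values on them. The required map acts on B^l-orbits, so [Phi]
    must first be shown injective: B_i(z)^-1 B_i(z') = y_i(z - z') lies in B only if z = z'. In
    coordinates each of the two maps is given by a polynomial involution, which therefore also
    serves as the inverse. *)

(** * Matrices of polynomials and one-parameter subgroups *)

Section PolynomialMatrices.
Variables (C : numClosedFieldType) (n : nat).
Implicit Types (A B : 'M[{poly C}]_n) (v w x : 'M[C]_n) (a b c : C) (p q : {poly C}).

Definition mxhorner A a : 'M[C]_n := map_mx (horner_eval a) A.
Definition mxderiv A : 'M[{poly C}]_n := map_mx deriv A.
Definition mxpolyC v : 'M[{poly C}]_n := map_mx polyC v.

Lemma mxhornerM A B a : mxhorner (A *m B) a = mxhorner A a *m mxhorner B a.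
Proof. exact: map_mxM. Qed.

Lemma mxhornerD A B a : mxhorner (A + B) a = mxhorner A a + mxhorner B a.
Proof. exact: map_mxD. Qed.

Lemma mxhornerB A B a : mxhorner (A - B) a = mxhorner A a - mxhorner B a.
Proof. exact: map_mxB. Qed.

Lemma mxhornerZ q A a : mxhorner (q *: A) a = q.[a] *: mxhorner A a.
Proof. exact: map_mxZ. Qed.

Lemma mxhornerC v a : mxhorner (mxpolyC v) a = v.
Proof. by apply/matrixP=> i j; rewrite !mxE /horner_eval hornerC. Qed.

Lemma poly_fun_inj p q : (forall a, p.[a] = q.[a]) -> p = q.
Proof.
move=> eqpq; apply/eqP; rewrite -subr_eq0; apply/eqP.
(* The naturals below the size of [p - q] are distinct in characteristic 0 and all of them are
   roots. *)
apply: (@roots_geq_poly_eq0 _ _ [seq k%:R | k <- iota 0 (size (p - q))]).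
- by apply/allP=> a _; rewrite rootE hornerD hornerN subr_eq0 eqpq.
- by rewrite map_inj_uniq ?iota_uniq // => k m /eqP; rewrite eqr_nat => /eqP.
- by rewrite size_map size_iota.
Qed.

Lemma mxhorner_inj A B : mxhorner A =1 mxhorner B -> A = B.
Proof.
move=> eqAB; apply/matrixP=> i j; apply: poly_fun_inj => a.
by move/matrixP: (eqAB a) => /(_ i j); rewrite !mxE.
Qed.

Lemma mxderivM A B : mxderiv (A *m B) = mxderiv A *m B + A *m mxderiv B.
Proof.
apply/matrixP=> i j; rewrite !mxE raddf_sum -big_split /=.
by apply: eq_bigr => k _; rewrite derivM !mxE.
Qed.

Lemma mxderivC v : mxderiv (mxpolyC v) = 0.
Proof. by apply/matrixP=> i j; rewrite !mxE derivC. Qed.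

Lemma mxderivD A B : mxderiv (A + B) = mxderiv A + mxderiv B.
Proof. by apply/matrixP=> i j; rewrite !mxE derivD. Qed.

Lemma mxderivX v : mxderiv ('X *: mxpolyC v) = mxpolyC v.
Proof. by apply/matrixP=> i j; rewrite !mxE derivM derivX derivC mul1r mulr0 addr0. Qed.

Lemma deriv_eq0_const q : q^`() = 0 -> forall a, q.[a] = q.[0].
Proof.
move=> q'0 a.
have qi k : q`_k.+1 = 0.
  have /eqP := congr1 (fun r : {poly C} => r`_k) q'0.
  by rewrite coef_deriv coef0 mulrn_eq0 => /eqP.
suff ->: q = (q`_0)%:P by rewrite !hornerC.
by apply/polyP=> -[|k]; rewrite coefC //= qi.
Qed.

Lemma mxderiv_eq0_const A : mxderiv A = 0 -> forall a, mxhorner A a = mxhorner A 0.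
Proof.
move=> /matrixP A'0 a; apply/matrixP=> i j; rewrite !mxE.
by apply: deriv_eq0_const; have := A'0 i j; rewrite !mxE.
Qed.

Lemma mxderiv_const A w : mxderiv A = mxpolyC w ->
  forall a, mxhorner A a = mxhorner A 0 + a *: w.
Proof.
move=> A'w a; have := @mxderiv_eq0_const (A - 'X *: mxpolyC w).
have ->: mxderiv (A - 'X *: mxpolyC w) = 0.
  apply/matrixP=> i j; move/matrixP: A'w => /(_ i j); rewrite !mxE => A'w.
  by rewrite derivB A'w derivM derivX derivC mul1r mulr0 addr0 subrr.
move=> /(_ erefl a); rewrite !mxhornerB !mxhornerZ !mxhornerC !hornerX scale0r.
by rewrite subr0 => <-; rewrite subrK.
Qed.

Definition mxcomp A q : 'M[{poly C}]_n := map_mx (comp_poly q) A.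

Lemma mxhorner_comp A q a : mxhorner (mxcomp A q) a = mxhorner A q.[a].
Proof. by apply/matrixP=> i j; rewrite !mxE /horner_eval horner_comp. Qed.

Lemma mxderiv_comp A q : mxderiv (mxcomp A q) = q^`() *: mxcomp (mxderiv A) q.
Proof. by apply/matrixP=> i j; rewrite !mxE deriv_comp mulrC. Qed.

(* Polynomial homomorphisms from the additive group, with derivative E at 0:
   in characteristic 0 these are the maps a |-> exp (a E) with E nilpotent. *)
Definition one_param (X : C -> 'M[C]_n) (E : 'M[C]_n) : Prop :=
  exists A, [/\ mxhorner A =1 X, X 0 = 1%:M,
                forall a b, X (a + b) = X a *m X b & mxhorner (mxderiv A) 0 = E].

Lemma one_param_generator_uniq X E E' : one_param X E -> one_param X E' -> E = E'.
Proof.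
move=> [A [AX _ _ <-]] [A' [A'X _ _ <-]].
by rewrite (@mxhorner_inj A A') // => a; rewrite AX A'X.
Qed.

Lemma eq_one_param X Y E : X =1 Y -> one_param X E -> one_param Y E.
Proof.
move=> XY [A [AX X0 XD dA]].
by exists A; split=> // [a|| a b]; rewrite -?XY // AX XY.
Qed.

Section OneParam.
Variables (X : C -> 'M[C]_n) (E : 'M[C]_n).
Hypothesis XE : one_param X E.

Lemma one_paramVr a : X a *m X (- a) = 1%:M.
Proof. by case: XE => A [_ <- XD _]; rewrite -XD subrr. Qed.

Lemma one_paramVl a : X (- a) *m X a = 1%:M.
Proof. by case: XE => A [_ <- XD _]; rewrite -XD addNr. Qed.

Lemma one_param_unit a : X a \in unitmx.
Proof. by have [] := mulmx1_unit (one_paramVr a). Qed.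

Lemma one_paramV a : invmx (X a) = X (- a).
Proof.
by rewrite -[RHS]mul1mx -(mulVmx (one_param_unit a)) -mulmxA one_paramVr mulmx1.
Qed.

(** Differentiate [X (a + b) = X a *m X b = X b *m X a] in one variable at 0, the other being fixed.
    Any polynomial matrix [A] with the values of [X] will do, because these values determine it. *)
Lemma one_param_deriv A : mxhorner A =1 X ->
  mxderiv A = A *m mxpolyC E /\ mxderiv A = mxpolyC E *m A.
Proof.
move=> AX; case: XE => A0 [A0X X0 XD dA0].
have {A0 A0X dA0} dA : mxhorner (mxderiv A) 0 = E.
  by rewrite -dA0 (@mxhorner_inj A A0) // => a; rewrite AX A0X.
suff dAE a : mxhorner (mxderiv A) a = X a *m E /\ mxhorner (mxderiv A) a = E *m X a.
  split; apply: mxhorner_inj => a; have [dl dr] := dAE a.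
    by rewrite mxhornerM mxhornerC AX.
  by rewrite mxhornerM mxhornerC AX.
have shl : mxcomp A ('X + a%:P) = mxpolyC (X a) *m A.
  apply: mxhorner_inj => b; rewrite mxhorner_comp mxhornerM mxhornerC !AX.
  by rewrite hornerD hornerX hornerC addrC XD.
have shr : mxcomp A ('X + a%:P) = A *m mxpolyC (X a).
  apply: mxhorner_inj => b; rewrite mxhorner_comp mxhornerM mxhornerC !AX.
  by rewrite hornerD hornerX hornerC XD.
have dsh : mxhorner (mxderiv (mxcomp A ('X + a%:P))) 0 = mxhorner (mxderiv A) a.
  rewrite mxderiv_comp derivD derivX derivC addr0 scale1r mxhorner_comp.
  by rewrite hornerD hornerX hornerC add0r.
by rewrite -{1}dsh -dsh {1}shl shr !mxderivM !mxderivC mulmx0 mul0mx addr0 add0r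
   !mxhornerM !mxhornerC dA.
Qed.

Lemma one_param_rescale c : one_param (fun a => X (c * a)) (c *: E).
Proof.
case: XE => A [AX X0 XD dA]; exists (mxcomp A (c *: 'X)); split.
- by move=> a; rewrite mxhorner_comp AX hornerZ hornerX.
- by rewrite mulr0.
- by move=> a b; rewrite mulrDr XD.
- by rewrite mxderiv_comp derivZ derivX mxhornerZ mxhorner_comp !hornerZ hornerX
     hornerC mulr1 mulr0 dA.
Qed.

Lemma one_param_adj g : g \in unitmx -> one_param (fun a => adj g (X a)) (adj g E).
Proof.
move=> ug; case: XE => A [AX X0 XD dA].
exists (mxpolyC g *m A *m mxpolyC (invmx g)); split.
- by move=> a; rewrite !mxhornerM !mxhornerC AX.
- by rewrite X0 /adj mulmx1 mulmxV.
- by move=> a b; rewrite XD /adj !mulmxA mulmxKV.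
- by rewrite !mxderivM !mxderivC mulmx0 mul0mx addr0 add0r !mxhornerM !mxhornerC dA.
Qed.

(** The differential equation d/da Ad(X a) v = Ad(X a) [E, v] stands in for Ad(exp(a E)) = exp(a ad
    E). The curve is polynomial because the inverse of [X a] is [X (- a)]. *)
Lemma one_param_adj_deriv v : exists2 A, forall a, mxhorner A a = adj (X a) v &
  forall a, mxhorner (mxderiv A) a = adj (X a) (lie_bracket E v).
Proof.
case: (XE) => A [AX X0 XD dA]; have [dl dr] := one_param_deriv AX.
have AN : mxhorner (mxcomp A (- 'X)) =1 (fun a => X (- a)).
  by move=> a; rewrite mxhorner_comp AX hornerN hornerX.
exists (A *m mxpolyC v *m mxcomp A (- 'X)) => a.
  by rewrite !mxhornerM mxhornerC AX AN /adj one_paramV.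
rewrite !mxderivM mxderivC mulmx0 addr0 dl mxderiv_comp dr derivN derivX.
rewrite mxhornerD !mxhornerM !mxhornerZ !mxhorner_comp !mxhornerM !mxhornerC !AX.
rewrite !hornerN hornerX hornerC /adj one_paramV /lie_bracket scaleN1r mulmxBr mulmxBl.
by rewrite !mulmxN !mulmxA.
Qed.

Lemma one_param_adj_fixed a v : lie_bracket E v = 0 -> adj (X a) v = v.
Proof.
move=> Ev; have [A Av A'v] := one_param_adj_deriv v.
rewrite -Av (@mxderiv_eq0_const A).
  by case: XE => ? [_ X0 _ _]; rewrite Av X0 /adj invmx1 mulmx1 mul1mx.
apply: mxhorner_inj => b; rewrite A'v Ev /adj mulmx0 mul0mx.
by apply/matrixP=> i j; rewrite !mxE /horner_eval horner0.
Qed.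

(** The exponential series of ad E on [v] stops after its linear term: the derivative of the curve
    is itself constant. *)
Lemma one_param_adj_affine a v : lie_bracket E (lie_bracket E v) = 0 ->
  adj (X a) v = v + a *: lie_bracket E v.
Proof.
move=> EEv; have [A Av A'v] := one_param_adj_deriv v.
rewrite -Av (@mxderiv_const A (lie_bracket E v)).
  by case: XE => ? [_ X0 _ _]; rewrite Av X0 /adj invmx1 mulmx1 mul1mx.
by apply: mxhorner_inj => b; rewrite A'v mxhornerC one_param_adj_fixed.
Qed.

End OneParam.

(** The curve [X a *m Y (- a)] has derivative X E Y - X E Y = 0 and starts at the identity. *)
Lemma one_param_uniq X Y E : one_param X E -> one_param Y E -> X =1 Y.
Proof.
move=> XE YE a; have [A [AX X0 _ _]] := XE; have [B [BY Y0 _ _]] := YE.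
have [dA _] := one_param_deriv XE AX; have [_ dB] := one_param_deriv YE BY.
have dZ : mxderiv (A *m mxcomp B (- 'X)) = 0.
  rewrite mxderivM dA mxderiv_comp dB derivN derivX.
  apply: mxhorner_inj => b; rewrite mxhornerD !mxhornerM mxhornerZ !mxhorner_comp.
  rewrite !mxhornerM !mxhornerC !hornerE scaleN1r mulmxN mulmxA subrr.
  by apply/matrixP=> i j; rewrite !mxE /horner_eval horner0.
have := mxderiv_eq0_const dZ a; rewrite !mxhornerM !mxhorner_comp AX BY.
rewrite !hornerN !hornerX oppr0 AX BY X0 Y0 mulmx1 => XY.
by rewrite -[LHS]mulmx1 -(one_paramVl YE a) mulmxA XY mul1mx.
Qed.

(** Conjugation by [X a] fixes the generator [K], hence fixes the subgroup [Y] that [K]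
    determines. *)
Lemma one_param_comm X Y E K a b : one_param X E -> one_param Y K ->
  lie_bracket E K = 0 -> X a *m Y b = Y b *m X a.
Proof.
move=> XE YK EK; have uX := one_param_unit XE a.
have /one_param_uniq/(_ YK)/(_ b) : one_param (fun c => adj (X a) (Y c)) K.
  by rewrite -(one_param_adj_fixed XE a EK); apply: one_param_adj.
by rewrite /adj => {2}<-; rewrite mulmxKV.
Qed.

Lemma one_param_mul X Y E K : one_param X E -> one_param Y K ->
  lie_bracket E K = 0 -> one_param (fun a => X a *m Y a) (E + K).
Proof.
move=> XE YK EK.
have XY a b := one_param_comm a b XE YK EK.
move: XE YK => [A [AX X0 XD dA]] [B [BY Y0 YD dB]].
exists (A *m B); split.
- by move=> a; rewrite mxhornerM AX BY.
- by rewrite X0 Y0 mulmx1.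
- by move=> a b; rewrite XD YD !mulmxA -(mulmxA (X a) (X b)) XY !mulmxA.
- by rewrite mxderivM mxhornerD !mxhornerM dA dB AX BY X0 Y0 mulmx1 mul1mx.
Qed.

End PolynomialMatrices.

(** * The chain rule along polynomial curves *)

Section ChainRule.
Variables (C : numClosedFieldType) (m : nat) (v : 'I_m -> {poly C}).
Implicit Types (f g : {mpoly C[m]}).

Lemma horner_mmap f a : (mmap polyC v f).[a] = f.@[fun k => (v k).[a]].
Proof.
elim/mpolyind: f => [|c u f _ _ IH]; first by rewrite !raddf0 horner0.
rewrite mmapD mevalD hornerD IH mmapZ mevalZ hornerM hornerC mmapX mevalX /mmap1.
by rewrite horner_prod; under eq_bigr => k _ do rewrite horner_exp.
Qed.

Let chain f :=
  (mmap polyC v f)^`() = \sum_k mmap polyC v f^`M(k) * (v k)^`().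

Let chainM f g : chain f -> chain g -> chain (f * g).
Proof.
move=> Hf Hg; rewrite /chain rmorphM derivM Hf Hg mulr_suml mulr_sumr -big_split /=.
by apply: eq_bigr => k _; rewrite mderivM mmapD !rmorphM /= mulrDl mulrAC !mulrA.
Qed.

Let chain1 : chain 1.
Proof.
rewrite /chain rmorph1 derivC big1 // => k _.
by rewrite -mpolyC1 mderivC mmap0 mul0r.
Qed.

Lemma deriv_mmap f :
  (mmap polyC v f)^`() = \sum_k mmap polyC v f^`M(k) * (v k)^`().
Proof.
elim/mpolyind: f => [|c u f _ _ IH].
  by rewrite mmap0 deriv0 big1 // => k _; rewrite mderiv0 mmap0 mul0r.
(* Both sides of the rule obey the Leibniz rule in the polynomial, so it passes from the variables
   to their powers and products. *)
have chainu : chain 'X_[u].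
  rewrite mpolyXE_id; elim/big_ind: _ => [||k _]; [exact: chain1|exact: chainM|].
  elim: (u k) => [|d IHd]; first by rewrite expr0; exact: chain1.
  rewrite exprS; apply: chainM => //; rewrite /chain mmapX mmap1U.
  rewrite (bigD1 k) //= big1 ?addr0 => [|k' nk].
    by rewrite mderivX mnm1E eqxx scale1r -{1}[U_(k)%MM]add0m addmK mpolyX0 rmorph1 mul1r.
  by rewrite mderivX mnm1E eq_sym (negPf nk) scale0r mmap0 mul0r.
rewrite mmapD derivD IH mmapZ derivM derivC mul0r add0r chainu mulr_sumr -big_split /=.
by apply: eq_bigr => k _; rewrite mderivD mderivZ mmapD mmapZ mulrDl mulrA.
Qed.

End ChainRule.

(** * Lie algebras of matrix groups *)

Section LieAlgebra.
Variables (C : numClosedFieldType) (n : nat).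
Implicit Types (f : {mpoly C[n * n]}) (A : 'M[{poly C}]_n).
Implicit Types (g h x y : 'M[C]_n) (H : set 'M[C]_n) (a : C).

Definition mxevalp f A : {poly C} := mmap polyC (fun k => mxvec A 0 k) f.

Lemma mxvec_mxhorner A a k : mxvec (mxhorner A a) 0 k = (mxvec A 0 k).[a].
Proof. by rewrite /mxhorner -map_mxvec mxE. Qed.

Lemma mxvec_mxderiv A k : mxvec (mxderiv A) 0 k = (mxvec A 0 k)^`().
Proof. by rewrite /mxderiv -map_mxvec mxE. Qed.

Lemma mxevalp_horner f A a : (mxevalp f A).[a] = mxeval f (mxhorner A a).
Proof. by rewrite horner_mmap; apply: meval_eq => k; rewrite mxvec_mxhorner. Qed.

Lemma mxevalp_deriv f A a :
  (mxevalp f A)^`().[a] = mxdiff f (mxhorner A a) (mxhorner (mxderiv A) a).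
Proof.
rewrite deriv_mmap horner_sum; apply: eq_bigr => k _.
rewrite hornerM horner_mmap mxvec_mxhorner mxvec_mxderiv; congr (_ * _).
by apply: meval_eq => k'; rewrite mxvec_mxhorner.
Qed.

(** A curve through the identity with velocity [x]. It may leave a given group at once, but [mxdiff]
    sees only its first order at 0. For an off-diagonal matrix unit of size 2 it is the unipotent
    subgroup itself. *)
Definition mxline x : 'M[{poly C}]_n := mxpolyC 1%:M + 'X *: mxpolyC x.

Lemma mxhorner_line x a : mxhorner (mxline x) a = 1%:M + a *: x.
Proof. by rewrite mxhornerD mxhornerZ !mxhornerC hornerX. Qed.

Lemma mxdiff_line f x : mxdiff f 1%:M x = (mxevalp f (mxline x))^`().[0].
Proof.
rewrite mxevalp_deriv mxhorner_line scale0r addr0 mxderivD mxderivC add0r.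
by rewrite mxderivX mxhornerC.
Qed.

Lemma mxdiffP f g a x y : mxdiff f g (a *: x + y) = a * mxdiff f g x + mxdiff f g y.
Proof.
rewrite /mxdiff mulr_sumr -big_split /=; apply: eq_bigr => k _.
by rewrite linearP /= !mxE mulrDr mulrCA.
Qed.

Lemma lie_algP H a x y : lie_alg H x -> lie_alg H y -> lie_alg H (a *: x + y).
Proof. by move=> Hx Hy f Hf; rewrite mxdiffP Hx ?Hy // mulr0 addr0. Qed.

Lemma lie_alg0 H : lie_alg H 0.
Proof. by move=> f _; rewrite /mxdiff big1 // => k _; rewrite linear0 mxE mulr0. Qed.

Lemma lie_algZ H a x : lie_alg H x -> lie_alg H (a *: x).
Proof. by move=> Hx; rewrite -[_ *: _]addr0; apply: lie_algP => //; exact: lie_alg0. Qed.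

Lemma lie_algD H x y : lie_alg H x -> lie_alg H y -> lie_alg H (x + y).
Proof. by move=> Hx Hy; rewrite -(scale1r x); apply: lie_algP. Qed.

Lemma lie_algN H x : lie_alg H x -> lie_alg H (- x).
Proof. by rewrite -scaleN1r; apply: lie_algZ. Qed.

Lemma lie_algB H x y : lie_alg H x -> lie_alg H y -> lie_alg H (x - y).
Proof. by move=> Hx /lie_algN; apply: lie_algD. Qed.

Lemma lie_alg_curve H A : (forall a, H (mxhorner A a)) -> mxhorner A 0 = 1%:M ->
  lie_alg H (mxhorner (mxderiv A) 0).
Proof.
move=> HA A0 f Hf; rewrite -A0 -mxevalp_deriv.
have -> : mxevalp f A = 0.
  by apply: poly_fun_inj => a; rewrite horner0 mxevalp_horner Hf.
by rewrite deriv0 horner0.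
Qed.

Lemma one_param_lie_alg H X (E : 'M[C]_n) :
  one_param X E -> (forall a, H (X a)) -> lie_alg H E.
Proof.
move=> [A [AX X0 _ <-]] HX; apply: lie_alg_curve; last by rewrite AX.
by move=> a; rewrite AX.
Qed.

(** The linear forms that cut out [lie_alg H] have constant coefficients, so they commute with
    differentiation along the curve. *)
Lemma lie_alg_deriv H A : (forall a, lie_alg H (mxhorner A a)) ->
  forall a, lie_alg H (mxhorner (mxderiv A) a).
Proof.
move=> HA a f Hf.
pose c k := (f^`M(k)).@[fun k' => mxvec (1%:M : 'M[C]_n) 0 k'].
pose q := \sum_k c k *: mxvec A 0 k.
have q0 : q = 0.
  apply: poly_fun_inj => b; rewrite horner0 -(HA b f Hf) horner_sum.
  by apply: eq_bigr => k _; rewrite hornerZ mxvec_mxhorner.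
have := congr1 (fun p : {poly C} => p^`().[a]) q0; rewrite deriv0 horner0 => <-.
rewrite raddf_sum horner_sum; apply: eq_bigr => k _.
by rewrite /= derivZ hornerZ mxvec_mxhorner mxvec_mxderiv.
Qed.

(** Conjugation as a linear substitution in the matrix entries: a polynomial vanishing on a set
    stable under [adj g] gives, after substitution, another one. *)
Definition conj_poly g : (n * n).-tuple {mpoly C[n * n]} :=
  [tuple \sum_k' lin_mx (mulmxr (invmx g) \o mulmx g) k' k *: 'X_k' | k < n * n].

Lemma mxeval_conj f g h : mxeval (f \mPo conj_poly g) h = mxeval f (adj g h).
Proof.
rewrite /mxeval comp_mpoly_meval; apply: meval_eq => k.
rewrite tnth_mktuple raddf_sum /= /adj.
have /= <- := mul_vec_lin (mulmxr (invmx g) \o mulmx g) h; rewrite mxE.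
by apply: eq_bigr => k' _; rewrite mevalZ mevalXU mulrC.
Qed.

Lemma lie_alg_adj H g x : g \in unitmx -> (forall h, H h -> H (adj g h)) ->
  lie_alg H x -> lie_alg H (adj g x).
Proof.
move=> ug Hg Hx f Hf.
have <- : mxdiff (f \mPo conj_poly g) 1%:M x = 0.
  by apply: Hx => h Hh; rewrite mxeval_conj Hf //; apply: Hg.
rewrite !mxdiff_line; congr (_^`().[_]); apply: poly_fun_inj => a.
rewrite !mxevalp_horner mxeval_conj !mxhorner_line; congr mxeval.
by rewrite /adj mulmxDr mulmxDl mulmx1 mulmxV // -scalemxAr -scalemxAl.
Qed.

(** The bracket is the velocity at 0 of [adj (X a) v], a curve that stays in [lie_alg H]. *)
Lemma lie_alg_bracket_one_param H X (E v : 'M[C]_n) : is_subgroup H ->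
  one_param X E -> (forall a, H (X a)) -> lie_alg H v -> lie_alg H (lie_bracket E v).
Proof.
move=> [Hu H1 HM HV] XE HX Hv; have [A Av A'v] := one_param_adj_deriv XE v.
have <- : mxhorner (mxderiv A) 0 = lie_bracket E v.
  by case: XE => ? [_ X0 _ _]; rewrite A'v X0 /adj invmx1 mulmx1 mul1mx.
apply: lie_alg_deriv => a; rewrite Av; apply: lie_alg_adj (Hv); first exact: Hu.
by move=> h Hh; apply: (HM); [exact: HM|exact: HV].
Qed.

Definition mxgrad f : 'M[C]_n :=
  (vec_mx (\row_k (f^`M(k)).@[fun k' => mxvec (1%:M : 'M[C]_n) 0 k']))^T.

Lemma mxtrace_mxgrad f x : \tr (mxgrad f *m x) = mxdiff f 1%:M x.
Proof.
pose F i j := (f^`M(mxvec_index i j)).@[fun k' => mxvec (1%:M : 'M[C]_n) 0 k'] *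
  mxvec x 0 (mxvec_index i j).
rewrite /mxdiff (reindex _ (curry_mxvec_bij n n)) /=.
rewrite (eq_bigr (fun p => F p.1 p.2)) => [|[] //]; rewrite -pair_bigA exchange_big /=.
apply: eq_bigr => i _; rewrite mxE; apply: eq_bigr => j _.
by rewrite !mxE /F mxvecE.
Qed.

(* A subspace cut out by linear forms is the annihilator of its annihilator. *)
Lemma lie_alg_annihilator H x :
  (forall xi, (forall y, lie_alg H y -> \tr (xi *m y) = 0) -> \tr (xi *m x) = 0) ->
  lie_alg H x.
Proof.
move=> Hx f Hf; rewrite -mxtrace_mxgrad; apply: Hx => y Hy.
by rewrite mxtrace_mxgrad Hy.
Qed.

End LieAlgebra.

(** * The adjoint action and the bracket *)

Section Adjoint.
Variables (C : numClosedFieldType) (n : nat).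
Implicit Types (g h x y : 'M[C]_n) (a : C).

Lemma mulmx_unit g h : g \in unitmx -> h \in unitmx -> g *m h \in unitmx.
Proof. by move=> ug uh; rewrite unitmx_mul ug. Qed.

Lemma invmxM g h : g \in unitmx -> h \in unitmx ->
  invmx (g *m h) = invmx h *m invmx g.
Proof.
move=> ug uh; have ugh := mulmx_unit ug uh.
by apply: (can_inj (mulKmx ugh)); rewrite mulmxV // mulmxA mulmxK // mulmxV.
Qed.

Lemma adj_comp g h x : g \in unitmx -> h \in unitmx ->
  adj g (adj h x) = adj (g *m h) x.
Proof. by move=> ug uh; rewrite /adj invmxM // !mulmxA. Qed.

Lemma adjM g x y : g \in unitmx -> adj g (x *m y) = adj g x *m adj g y.
Proof. by move=> ug; rewrite /adj !mulmxA mulmxKV. Qed.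

Lemma adjD g x y : adj g (x + y) = adj g x + adj g y.
Proof. by rewrite /adj mulmxDr mulmxDl. Qed.

Lemma adjN g x : adj g (- x) = - adj g x.
Proof. by rewrite /adj mulmxN mulNmx. Qed.

Lemma adjB g x y : adj g (x - y) = adj g x - adj g y.
Proof. by rewrite adjD adjN. Qed.

Lemma adjZ g a x : adj g (a *: x) = a *: adj g x.
Proof. by rewrite /adj -scalemxAr -scalemxAl. Qed.

Lemma adj_bracket g x y : g \in unitmx ->
  adj g (lie_bracket x y) = lie_bracket (adj g x) (adj g y).
Proof. by move=> ug; rewrite /lie_bracket adjB !adjM. Qed.

Lemma adjK g x : g \in unitmx -> adj (invmx g) (adj g x) = x.
Proof. by move=> ug; rewrite /adj invmxK !mulmxA mulVmx // mul1mx mulmxKV. Qed.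

Lemma adj_eq0 g x : g \in unitmx -> adj g x = 0 -> x = 0.
Proof. by move=> ug gx; rewrite -(adjK x ug) gx /adj mulmx0 mul0mx. Qed.

Lemma bracketC x y : lie_bracket x y = - lie_bracket y x.
Proof. by rewrite /lie_bracket opprB. Qed.

Lemma bracketZr a x y : lie_bracket x (a *: y) = a *: lie_bracket x y.
Proof. by rewrite /lie_bracket -scalemxAr -scalemxAl scalerBr. Qed.

Lemma bracketZl a x y : lie_bracket (a *: x) y = a *: lie_bracket x y.
Proof. by rewrite /lie_bracket -scalemxAr -scalemxAl scalerBr. Qed.

Lemma bracketNr x y : lie_bracket x (- y) = - lie_bracket x y.
Proof. by rewrite -scaleN1r bracketZr scaleN1r. Qed.

End Adjoint.

(** * Identities in SL_2 *)

Section SL2.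
Variable C : numClosedFieldType.
Implicit Types a b c d z : C.

Lemma mul_mx2 a b c d a' b' c' d' : mx2 a b c d *m mx2 a' b' c' d' =
  mx2 (a * a' + b * c') (a * b' + b * d') (c * a' + d * c') (c * b' + d * d').
Proof.
apply/matrixP=> r s; rewrite !mxE !big_ord_recl big_ord0 addr0 !mxE /=.
by case: r => [[|[|//]] ?]; case: s => [[|[|//]] ?].
Qed.

Lemma det_mx2 a b c d : \det (mx2 a b c d) = a * d - b * c.
Proof.
rewrite (expand_det_row _ 0) !big_ord_recl big_ord0 addr0 /cofactor !det_mx11 !mxE /=.
by rewrite expr0 mul1r expr1 mulN1r mulrN.
Qed.

Lemma mx2_1 : mx2 1 0 0 1 = 1%:M :> 'M[C]_2.
Proof.
apply/matrixP=> r s; rewrite !mxE.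
by case: r => [[|[|//]] ?]; case: s => [[|[|//]] ?].
Qed.

Lemma det_mxU z : \det (mxU z) = 1.
Proof. by rewrite det_mx2 mulr0 subr0 mulr1. Qed.

Lemma det_mxL z : \det (mxL z) = 1.
Proof. by rewrite det_mx2 mul0r subr0 mulr1. Qed.

Lemma det_mxS : \det (mxS C) = 1.
Proof. by rewrite det_mx2 mulr1 mul0r sub0r opprK. Qed.

Lemma det_mxD a : a != 0 -> \det (mxD a) = 1.
Proof. by move=> a0; rewrite det_mx2 mulr0 subr0 mulfV. Qed.

Lemma mxU_add a b : mxU (a + b) = mxU a *m mxU b.
Proof. by rewrite mul_mx2; congr mx2; ring. Qed.

Lemma mxL_add a b : mxL (a + b) = mxL a *m mxL b.
Proof. by rewrite mul_mx2; congr mx2; ring. Qed.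

Lemma mxD_mul a b : mxD (a * b) = mxD a *m mxD b.
Proof. by rewrite /mxD invfM mul_mx2; congr mx2; ring. Qed.

Lemma mxU_line z : mxhorner (mxline (delta_mx 0 1)) z = mxU z.
Proof.
rewrite mxhorner_line; apply/matrixP=> r s; rewrite !mxE.
case: r => [[|[|//]] ?]; case: s => [[|[|//]] ?] //=;
  by rewrite ?(mulr1, mulr0, addr0, add0r).
Qed.

Lemma mxL_line z : mxhorner (mxline (delta_mx 1 0)) z = mxL z.
Proof.
rewrite mxhorner_line; apply/matrixP=> r s; rewrite !mxE.
case: r => [[|[|//]] ?]; case: s => [[|[|//]] ?] //=;
  by rewrite ?(mulr1, mulr0, addr0, add0r).
Qed.

Lemma mxderiv_line m (x : 'M[C]_m) z : mxhorner (mxderiv (mxline x)) z = x.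
Proof. by rewrite mxderivD mxderivC add0r mxderivX mxhornerC. Qed.

(** Two factorisations of the Weyl representative, so that conjugation can begin with a factor
    fixing the vector: for [j] different from [i], the upper unipotents of [i] fix F_j and the lower
    ones fix E_j. *)
Lemma mxS_ULU : mxS C = mxU (-1) *m mxL 1 *m mxU (-1).
Proof. by rewrite !mul_mx2; congr mx2; ring. Qed.

Lemma mxS_LUL : mxS C = mxL 1 *m mxU (-1) *m mxL 1.
Proof. by rewrite !mul_mx2; congr mx2; ring. Qed.

Lemma mxD_mxS a : a != 0 -> mxD a *m mxS C = mxU (- a) *m mxL a^-1 *m mxU (- a).
Proof. by move=> a0; rewrite !mul_mx2; congr mx2; field. Qed.

Lemma mxD_mxS_comm a : mxD a *m mxS C = mxS C *m mxD a^-1.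
Proof. by rewrite !mul_mx2 invrK; congr mx2; ring. Qed.

Lemma mxU_mxS z : mxU z *m mxS C = mxS C *m mxL (- z).
Proof. by rewrite !mul_mx2; congr mx2; ring. Qed.

Lemma mxD_mxU a z : a != 0 -> mxD a *m mxU z = mxU (a ^+ 2 * z) *m mxD a.
Proof. by move=> a0; rewrite !mul_mx2; congr mx2; field. Qed.

End SL2.

Section PhiPoly.
Variables (C : numClosedFieldType) (I : finType) (n : nat) (D : group_data C I n).

Definition phi_poly i (A : 'M[{poly C}]_2) : 'M[{poly C}]_n :=
  map_mx (fun f => mxevalp f A) (pin D i).

Lemma mxhorner_phi i A a : mxhorner (phi_poly i A) a = phi D i (mxhorner A a).
Proof. by apply/matrixP=> r s; rewrite !mxE /horner_eval mxevalp_horner. Qed.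

Lemma mxderiv_phi i A a : mxhorner (mxderiv (phi_poly i A)) a =
  dphi D i (mxhorner A a) (mxhorner (mxderiv A) a).
Proof. by apply/matrixP=> r s; rewrite !mxE /horner_eval mxevalp_deriv. Qed.

End PhiPoly.

(** Since 2 has infinite order, integral weights can be read off from the value of a cocharacter at
    2 alone. *)
Lemma two_exprz_inj (C : numClosedFieldType) (m k : int) :
  2 ^ m = 2 ^ k :> C -> m = k.
Proof.
have two0 : 2 != 0 :> C by rewrite pnatr_eq0.
move=> /(congr1 (fun c => c * 2 ^ (- k))); rewrite -!expfzDr // subrr expr0z => /eqP.
by rewrite pexprz_eq1 ?ler0n // (eqr_nat C 2 1) orbF subr_eq0 => /eqP.
Qed.

(** * Root subgroups and Weyl group representatives *)

Section PinnedGroup.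
Variables (C : numClosedFieldType) (I : finType) (n : nat) (D : group_data C I n).
Hypothesis hD : is_pinned_simply_laced_group D.
Implicit Types (i j : I) (t x y : 'M[C]_n) (a z : C).

Local Notation G := (gr D).
Local Notation B := (bor D).
Local Notation T := (tor D).

Lemma gr_subgroup : is_subgroup G.
Proof. by case: hD => [[[]]]. Qed.

Lemma bor_subgroup : is_subgroup B.
Proof. by case: hD => [_ [[[[]]]]]. Qed.

Lemma tor_subgroup : is_subgroup T.
Proof.
case: hD => [_ [[[[[u1 o1 m1 v1] _] _ _ _] _] [[[[u2 o2 m2 v2] _] _ _ _] _] _] _ _ _].
split=> [g [/u1]||g h [Bg B'g] [Bh B'h]|g [Bg B'g]] //; split;
  by [exact: m1|exact: m2|exact: v1|exact: v2].
Qed.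

Lemma gr_unit g : G g -> g \in unitmx.
Proof. by case: gr_subgroup => + _ _ _; apply. Qed.

Lemma bor_unit g : B g -> g \in unitmx.
Proof. by case: bor_subgroup => + _ _ _; apply. Qed.

Lemma tor_unit t : T t -> t \in unitmx.
Proof. by case: tor_subgroup => + _ _ _; apply. Qed.

Lemma torM t t' : T t -> T t' -> T (t *m t').
Proof. by case: tor_subgroup => _ _ + _; apply. Qed.

Lemma tor_bor t : T t -> B t.
Proof. by case. Qed.

Lemma gr_adj_stable g h : G g -> G h -> G (adj g h).
Proof. by case: gr_subgroup => _ _ gM gV Gg Gh; apply: (gM) (gV _ Gg); apply: gM. Qed.

Lemma bor_adj_stable g h : B g -> B h -> B (adj g h).
Proof. by case: bor_subgroup => _ _ gM gV Gg Gh; apply: (gM) (gV _ Gg); apply: gM. Qed.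

Lemma lie_gr_adj g x : G g -> lie_alg G x -> lie_alg G (adj g x).
Proof.
by move=> Gg; apply: lie_alg_adj => [|h]; [exact: gr_unit|exact: gr_adj_stable].
Qed.

Lemma lie_bor_adj g x : B g -> lie_alg B x -> lie_alg B (adj g x).
Proof.
by move=> Bg; apply: lie_alg_adj => [|h]; [exact: bor_unit|exact: bor_adj_stable].
Qed.

Lemma pinningP : is_pinning D.
Proof. by case: hD => _ _ _ _ []. Qed.

Lemma phi_gr i g : \det g = 1 -> G (phi D i g).
Proof. by case: (pinningP i) => + _ _ _ _; apply. Qed.

Lemma phi1 i : phi D i 1%:M = 1%:M.
Proof. by case: (pinningP i) => _ [+ _] _ _ _; apply. Qed.

Lemma phiM i g h : \det g = 1 -> \det h = 1 -> phi D i (g *m h) = phi D i g *m phi D i h.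
Proof. by case: (pinningP i) => _ [_ +] _ _ _; apply. Qed.

Definition xroot i z := phi D i (mxU z).
Definition yroot i z := phi D i (mxL z).
Definition eroot i := dphi D i 1%:M (delta_mx 0 1).
Definition froot i := dphi D i 1%:M (delta_mx 1 0).
Definition hroot i a := phi D i (mxD a).

Local Notation X := xroot.
Local Notation Y := yroot.
Local Notation E := eroot.
Local Notation F := froot.
Local Notation S := (weyl_rep D).
Local Notation alpha := (sroot D).

Lemma xroot_one_param i : one_param (X i) (E i).
Proof.
exists (phi_poly D i (mxline (delta_mx 0 1))); split=> [a||a b|].
- by rewrite mxhorner_phi mxU_line.
- by rewrite /X /mxU mx2_1 phi1.
- by rewrite /X mxU_add phiM ?det_mxU.
- by rewrite mxderiv_phi mxderiv_line mxhorner_line scale0r addr0.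
Qed.

Lemma yroot_one_param i : one_param (Y i) (F i).
Proof.
exists (phi_poly D i (mxline (delta_mx 1 0))); split=> [a||a b|].
- by rewrite mxhorner_phi mxL_line.
- by rewrite /Y /mxL mx2_1 phi1.
- by rewrite /Y mxL_add phiM ?det_mxL.
- by rewrite mxderiv_phi mxderiv_line mxhorner_line scale0r addr0.
Qed.

Lemma dphi_mxU i z : dphi D i (mxU z) (delta_mx 0 1) = X i z *m E i.
Proof.
have AX : mxhorner (phi_poly D i (mxline (delta_mx 0 1))) =1 X i.
  by move=> a; rewrite mxhorner_phi mxU_line.
have [dA _] := one_param_deriv (xroot_one_param i) AX.
by rewrite -mxU_line -{2}(mxderiv_line (delta_mx 0 1) z) -mxderiv_phi dA
   mxhornerM mxhornerC AX.
Qed.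

Lemma xroot_gr i z : G (X i z).
Proof. by apply: phi_gr; rewrite det_mxU. Qed.

Lemma yroot_gr i z : G (Y i z).
Proof. by apply: phi_gr; rewrite det_mxL. Qed.

Lemma weyl_gr i : G (S i).
Proof. by apply: phi_gr; rewrite det_mxS. Qed.

Lemma weyl_unit i : S i \in unitmx.
Proof. exact: gr_unit (weyl_gr i). Qed.

Lemma eroot_lie i : lie_alg G (E i).
Proof. exact: one_param_lie_alg (xroot_one_param i) (xroot_gr i). Qed.

Lemma froot_lie i : lie_alg G (F i).
Proof. exact: one_param_lie_alg (yroot_one_param i) (yroot_gr i). Qed.

Lemma hroot_tor i a : a != 0 -> T (hroot i a).
Proof. by case: (pinningP i) => _ _ + _ _; apply. Qed.

Lemma adj_xroot i t z : T t -> adj t (X i z) = X i (alpha i t * z).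
Proof. by case: (pinningP i) => _ _ _ _ /(_ t z) tX /tX[]. Qed.

Lemma adj_yroot i t z : T t -> adj t (Y i z) = Y i ((alpha i t)^-1 * z).
Proof. by case: (pinningP i) => _ _ _ _ /(_ t z) tX /tX[]. Qed.

(** A vanishing generator would make [X i] constant by uniqueness, against the injectivity required
    of a pinning. *)
Lemma eroot_neq0 i : E i <> 0.
Proof.
move=> Ei0; have [_ _ _ Xinj _] := pinningP i.
have one_cst : one_param (fun=> 1%:M) (0 : 'M[C]_n).
  exists (mxpolyC 1%:M); split=> [a||a b|] //; rewrite ?mxhornerC ?mulmx1 //.
  by rewrite mxderivC; apply/matrixP=> r s; rewrite !mxE /horner_eval horner0.
have XE := xroot_one_param i; rewrite Ei0 in XE.
have /Xinj/eqP : X i 1 = X i 0 by rewrite !(one_param_uniq XE one_cst).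
by rewrite oner_eq0.
Qed.

Lemma weyl_ULU i : S i = X i (-1) *m Y i 1 *m X i (-1).
Proof. by rewrite /weyl_rep mxS_ULU !phiM ?det_mulmx ?det_mxU ?det_mxL ?mulr1. Qed.

Lemma weyl_LUL i : S i = Y i 1 *m X i (-1) *m Y i 1.
Proof. by rewrite /weyl_rep mxS_LUL !phiM ?det_mulmx ?det_mxU ?det_mxL ?mulr1. Qed.

Lemma xroot_weyl i z : X i z *m S i = S i *m Y i (- z).
Proof. by rewrite -!phiM ?det_mxU ?det_mxS ?det_mxL // mxU_mxS. Qed.

Lemma adj_weyl_ULU i v : adj (S i) v = adj (X i (-1)) (adj (Y i 1) (adj (X i (-1)) v)).
Proof.
have uX := gr_unit (xroot_gr i (-1)); have uY := gr_unit (yroot_gr i 1).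
by rewrite weyl_ULU -!adj_comp ?mulmx_unit.
Qed.

Lemma adj_weyl_LUL i v : adj (S i) v = adj (Y i 1) (adj (X i (-1)) (adj (Y i 1) v)).
Proof.
have uX := gr_unit (xroot_gr i (-1)); have uY := gr_unit (yroot_gr i 1).
by rewrite weyl_LUL -!adj_comp ?mulmx_unit.
Qed.

Lemma adj_weyl_froot i : adj (S i) (F i) = - E i.
Proof.
have uS := weyl_unit i.
apply: (@one_param_generator_uniq _ _ (fun a => X i (-1 * a))).
  apply: eq_one_param (one_param_adj (yroot_one_param i) uS) => a.
  by rewrite /adj -[a in LHS]opprK -xroot_weyl mulmxK // mulN1r.
by rewrite -(scaleN1r (E i)); exact: one_param_rescale (xroot_one_param i) (-1).
Qed.

Lemma adj_invweyl_eroot i : adj (invmx (S i)) (E i) = - F i.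
Proof. by rewrite -[E i]opprK -adj_weyl_froot adjN adjK ?weyl_unit. Qed.

Lemma froot_neq0 i : F i <> 0.
Proof.
move=> Fi0; apply: (@eroot_neq0 i).
by rewrite -[E i]opprK -adj_weyl_froot Fi0 /adj mulmx0 mul0mx oppr0.
Qed.

Lemma adj_tor_eroot i t : T t -> adj t (E i) = alpha i t *: E i.
Proof.
move=> Tt; have XE := xroot_one_param i; have ut := tor_unit Tt.
apply: one_param_generator_uniq (one_param_adj XE ut) _.
apply: eq_one_param (one_param_rescale XE (alpha i t)) => a.
by rewrite adj_xroot.
Qed.

Lemma adj_tor_froot i t : T t -> adj t (F i) = (alpha i t)^-1 *: F i.
Proof.
move=> Tt; have YF := yroot_one_param i; have ut := tor_unit Tt.
apply: one_param_generator_uniq (one_param_adj YF ut) _.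
apply: eq_one_param (one_param_rescale YF (alpha i t)^-1) => a.
by rewrite adj_yroot.
Qed.

Lemma scalerI_neq0 (v : 'M[C]_n) a a' : v <> 0 -> a *: v = a' *: v -> a = a'.
Proof.
move=> /eqP v0 /eqP; rewrite -subr_eq0 -scalerBl scaler_eq0 (negPf v0) orbF.
by rewrite subr_eq0 => /eqP.
Qed.

Lemma srootM i t t' : T t -> T t' -> alpha i (t *m t') = alpha i t * alpha i t'.
Proof.
move=> Tt Tt'; apply: scalerI_neq0 (eroot_neq0 (i := i)) _.
rewrite -adj_tor_eroot; last exact: torM.
by rewrite -adj_comp ?tor_unit // !(adj_tor_eroot, adjZ) // scalerA mulrC.
Qed.

Lemma sroot_neq0 i t : T t -> alpha i t != 0.
Proof.
move=> Tt; apply/eqP=> ait0; apply: (@eroot_neq0 i).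
by apply: (adj_eq0 (tor_unit Tt)); rewrite adj_tor_eroot // ait0 scale0r.
Qed.

Lemma sroot_hroot i j a : a != 0 -> alpha j (hroot i a) = a ^ cartan D i j.
Proof. by move=> a0; case: hD => _ _ _ [+ _] _; apply. Qed.

(** Inside SL_2, conjugation by diag(2, 1/2) rescales the upper unipotents by 4, so alpha_i takes
    the value 2^2 at h_i(2). *)
Lemma cartan_diag i : cartan D i i = 2.
Proof.
have two0 : 2 != 0 :> C by rewrite pnatr_eq0.
have Th := hroot_tor i two0; have := sroot_hroot i i two0.
have -> : alpha i (hroot i 2) = 2 ^ 2%:Z.
  apply: scalerI_neq0 (eroot_neq0 (i := i)) _; rewrite -adj_tor_eroot //.
  apply: one_param_generator_uniq (one_param_adj (xroot_one_param i) (tor_unit Th)) _.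
  apply: eq_one_param (one_param_rescale (xroot_one_param i) (2 ^ 2%:Z)) => a.
  rewrite /adj /hroot /X -phiM ?det_mxD ?det_mxU // mxD_mxU //.
  by rewrite phiM ?det_mxD ?det_mxU // mulmxK ?(tor_unit Th).
by move=> /two_exprz_inj.
Qed.

(** * The action of the Weyl group *)

(** The simple reflection s_i acting on the torus: [t] is multiplied by the coroot of [i] evaluated
    at the inverse of alpha_i(t). *)
Definition reflect_tor i t := hroot i (alpha i t)^-1 *m t.

Lemma reflect_tor_tor i t : T t -> T (reflect_tor i t).
Proof. by move=> Tt; apply: torM => //; apply: hroot_tor; rewrite invr_eq0 sroot_neq0. Qed.

Lemma sroot_reflect i j t : T t ->
  alpha j (reflect_tor i t) = alpha i t ^ (- cartan D i j) * alpha j t.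
Proof.
move=> Tt; have ai0 : (alpha i t)^-1 != 0 by rewrite invr_eq0 sroot_neq0.
by rewrite srootM ?sroot_hroot ?exprz_inv //; apply: hroot_tor.
Qed.

Lemma reflect_torK i t : T t -> reflect_tor i (reflect_tor i t) = t.
Proof.
move=> Tt; have a0 := sroot_neq0 i Tt.
rewrite {1}/reflect_tor sroot_reflect // cartan_diag.
have -> : alpha i t ^ (- 2%:Z) * alpha i t = (alpha i t)^-1.
  by rewrite -invr_expz -exprnP expr2 invfM mulfVK.
rewrite invrK /reflect_tor mulmxA /hroot -phiM ?det_mxD ?invr_eq0 //.
by rewrite -mxD_mul mulfV // /mxD invr1 mx2_1 phi1 mul1mx.
Qed.

(** Conjugation by [t] rescales the factors of s_i = x_i(-1) y_i(1) x_i(-1). With a = alpha_i(t) the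
    result x_i(-a) y_i(1/a) x_i(-a) is h_i(a) s_i, by a computation in SL_2. *)
Lemma tor_weyl i t : T t -> t *m S i = S i *m reflect_tor i t.
Proof.
move=> Tt; have a0 := sroot_neq0 i Tt; have ut := tor_unit Tt.
have a0V : (alpha i t)^-1 != 0 by rewrite invr_eq0.
suff tS : adj t (S i) = hroot i (alpha i t) *m S i.
  rewrite -[LHS](mulmxKV ut) -/(adj t (S i)) tS /reflect_tor mulmxA.
  by rewrite /hroot /weyl_rep -!phiM ?det_mxD ?det_mxS // mxD_mxS_comm.
rewrite {1}weyl_ULU !adjM // !adj_xroot // adj_yroot // mulr1 mulrN1.
rewrite /hroot /weyl_rep -phiM ?det_mxD ?det_mxS // mxD_mxS //.
by rewrite !phiM ?det_mulmx ?det_mxU ?det_mxL ?mulr1.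
Qed.

Lemma tor_invweyl i t : T t -> t *m invmx (S i) = invmx (S i) *m reflect_tor i t.
Proof.
move=> Tt; have uS := weyl_unit i; apply: (can_inj (mulmxK uS)).
rewrite mulmxKV // -mulmxA (tor_weyl i (reflect_tor_tor i Tt)) reflect_torK //.
by rewrite mulKmx.
Qed.

End PinnedGroup.

(** * Weights in the span of two simple roots *)

Section Weights.
Variables (C : numClosedFieldType) (I : finType) (n : nat) (D : group_data C I n).
Hypothesis hD : is_pinned_simply_laced_group D.
Implicit Types (i j : I) (t x y v : 'M[C]_n) (a z : C) (p q : int).

Local Notation G := (gr D).
Local Notation B := (bor D).
Local Notation T := (tor D).
Local Notation X := (xroot D).
Local Notation Y := (yroot D).
Local Notation E := (eroot D).
Local Notation F := (froot D).
Local Notation S := (weyl_rep D).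
Local Notation alpha := (sroot D).

Definition root_comb i j p q t := alpha i t ^ p * alpha j t ^ q.

Definition wt i j p q : set 'M[C]_n := weight_space G T (root_comb i j p q).

Lemma wtC i j p q x : wt i j p q x -> wt j i q p x.
Proof. by case=> Lx xt; split=> // t Tt; rewrite xt // /root_comb mulrC. Qed.

Lemma wt_eroot_l i j : wt i j 1 0 (E i).
Proof.
split; first exact: eroot_lie hD i.
by move=> t Tt; rewrite (adj_tor_eroot hD) // /root_comb expr0z mulr1 expr1z.
Qed.

Lemma wt_froot_l i j : wt i j (-1) 0 (F i).
Proof.
split; first exact: froot_lie hD i.
by move=> t Tt; rewrite (adj_tor_froot hD) // /root_comb expr0z mulr1 exprN1.
Qed.

Lemma wt_eroot_r i j : wt i j 0 1 (E j).
Proof. exact: wtC (wt_eroot_l j i). Qed.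

Lemma wt_froot_r i j : wt i j 0 (-1) (F j).
Proof. exact: wtC (wt_froot_l j i). Qed.

Lemma wt0 i j p q : wt i j p q 0.
Proof.
by split=> [|t Tt]; [exact: lie_alg0|rewrite /adj mulmx0 mul0mx scaler0].
Qed.

Lemma wtP i j p q a x y : wt i j p q x -> wt i j p q y -> wt i j p q (a *: x + y).
Proof.
move=> [Lx xt] [Ly yt]; split=> [|t Tt]; first exact: lie_algP.
by rewrite adjD adjZ xt // yt // scalerDr !scalerA mulrC.
Qed.

Lemma wtZ i j p q a x : wt i j p q x -> wt i j p q (a *: x).
Proof. by move=> Wx; rewrite -[_ *: _]addr0; apply: wtP => //; apply: wt0. Qed.

Lemma wtD i j p q x y : wt i j p q x -> wt i j p q y -> wt i j p q (x + y).
Proof. by move=> Wx Wy; rewrite -(scale1r x); apply: wtP. Qed.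

Lemma wtN i j p q x : wt i j p q x -> wt i j p q (- x).
Proof. by move=> Wx; rewrite -scaleN1r; apply: wtZ. Qed.

Lemma root_combD i j p q p' q' t : T t ->
  root_comb i j (p + p') (q + q') t = root_comb i j p q t * root_comb i j p' q' t.
Proof.
by move=> Tt; rewrite /root_comb !expfzDr ?(sroot_neq0 hD) // mulrACA.
Qed.

(** Membership of the bracket in Lie G is assumed here; it is supplied below when [x] generates a
    root subgroup, by differentiating its adjoint action. *)
Lemma wt_bracket i j p q p' q' x y :
  lie_alg G (lie_bracket x y) -> wt i j p q x -> wt i j p' q' y ->
  wt i j (p + p') (q + q') (lie_bracket x y).
Proof.
move=> Lxy [_ xt] [_ yt]; split=> // t Tt.
rewrite adj_bracket ?(tor_unit hD) // xt // yt // bracketZl bracketZr scalerA.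
by rewrite root_combD.
Qed.

Lemma lie_bracket_eroot i x : lie_alg G x -> lie_alg G (lie_bracket (E i) x).
Proof.
exact: lie_alg_bracket_one_param (gr_subgroup hD) (xroot_one_param hD i) (xroot_gr hD i).
Qed.

Lemma lie_bracket_froot i x : lie_alg G x -> lie_alg G (lie_bracket (F i) x).
Proof.
exact: lie_alg_bracket_one_param (gr_subgroup hD) (yroot_one_param hD i) (yroot_gr hD i).
Qed.

Lemma wt_bracket_eroot i j p q x :
  wt i j p q x -> wt i j (1 + p) q (lie_bracket (E i) x).
Proof.
move=> Wx; rewrite -(add0r q); apply: wt_bracket (wt_eroot_l i j) (Wx).
by case: Wx => Lx _; apply: lie_bracket_eroot.
Qed.

Lemma wt_bracket_froot i j p q x :
  wt i j p q x -> wt i j (-1 + p) q (lie_bracket (F i) x).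
Proof.
move=> Wx; rewrite -(add0r q); apply: wt_bracket (wt_froot_l i j) (Wx).
by case: Wx => Lx _; apply: lie_bracket_froot.
Qed.

Lemma root_comb_reflect i j p q t : T t -> root_comb i j p q (reflect_tor D i t) =
  root_comb i j (- p - cartan D i j * q) q t.
Proof.
move=> Tt; have ai0 := sroot_neq0 hD i Tt; have aj0 := sroot_neq0 hD j Tt.
rewrite /root_comb !(sroot_reflect hD) // (cartan_diag hD).
rewrite !exprzMl ?unitfE ?expfz_neq0 // !exprz_exp -expfzDr // mulrA -expfzDr //.
by congr (_ ^ _ * _); ring.
Qed.

Lemma wt_weyl i j p q x : wt i j p q x ->
  wt i j (- p - cartan D i j * q) q (adj (S i) x).
Proof.
move=> [Lx xt]; have uS := weyl_unit hD i; split=> [|t Tt].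
  by apply: (lie_gr_adj hD) => //; apply: weyl_gr hD i.
have Tt' := reflect_tor_tor hD i Tt; have ut := tor_unit hD Tt.
rewrite adj_comp // (tor_weyl hD) // -adj_comp ?(tor_unit hD Tt') // xt // adjZ.
by rewrite root_comb_reflect.
Qed.

Lemma wt_invweyl i j p q x : wt i j p q x ->
  wt i j (- p - cartan D i j * q) q (adj (invmx (S i)) x).
Proof.
move=> [Lx xt]; have uS : invmx (S i) \in unitmx by rewrite unitmx_inv (weyl_unit hD).
split=> [|t Tt].
  apply: (lie_gr_adj hD) => //; case: (gr_subgroup hD) => _ _ _; apply.
  exact: weyl_gr hD i.
have Tt' := reflect_tor_tor hD i Tt; have ut := tor_unit hD Tt.
rewrite adj_comp // (tor_invweyl hD) // -adj_comp ?(tor_unit hD Tt') // xt // adjZ.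
by rewrite root_comb_reflect.
Qed.

Lemma sroot_simple : is_simple_roots G B T alpha.
Proof. by case: hD. Qed.

Definition pair_comb i j p q : I -> int :=
  fun k => if k == i then p else if k == j then q else 0.

Lemma prod_pair_comb i j p q t : i != j ->
  \prod_k alpha k t ^ pair_comb i j p q k = root_comb i j p q t.
Proof.
move=> nij; rewrite (bigD1 i) // (bigD1 j) 1?eq_sym //= /pair_comb eqxx.
rewrite eq_sym (negPf nij) eqxx big1 ?mulr1 // => k /andP[/negPf-> /negPf->].
by rewrite expr0z.
Qed.

(** Independence of the simple roots is applied to the difference of the two families of
    exponents. *)
Lemma root_comb_indep i j p q c : i != j ->
  eq_char T (root_comb i j p q) (fun t => \prod_k alpha k t ^ c k) ->
  c i = p /\ c j = q.
Proof.
move=> nij eqc; have [_ indep _] := sroot_simple.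
have c0 : forall k, c k - pair_comb i j p q k = 0.
  apply: (indep (fun k => c k - pair_comb i j p q k)) => t Tt.
  have an0 k : alpha k t != 0 by apply: (sroot_neq0 hD).
  rewrite (eq_bigr (fun k => alpha k t ^ c k * (alpha k t ^ pair_comb i j p q k)^-1)).
    rewrite big_split prodfV /= -eqc // prod_pair_comb // mulfV //.
    by rewrite mulf_neq0 // expfz_neq0.
  by move=> k _; rewrite expfzDr // invr_expz.
have := c0 i; have := c0 j; rewrite /pair_comb !eqxx eq_sym (negPf nij).
by move=> /eqP + /eqP; rewrite !subr_eq0 => /eqP-> /eqP->.
Qed.

Lemma root_comb_inj i j p q p' q' : i != j ->
  eq_char T (root_comb i j p q) (root_comb i j p' q') -> p = p' /\ q = q'.
Proof.
move=> nij e; have [|<- <-] := @root_comb_indep i j p q (pair_comb i j p' q') nij.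
  by move=> t Tt; rewrite prod_pair_comb // e.
by rewrite /pair_comb !eqxx eq_sym (negPf nij).
Qed.

Lemma wt_disjoint i j p q p' q' x : i != j -> (p, q) != (p', q') ->
  wt i j p q x -> wt i j p' q' x -> x = 0.
Proof.
move=> nij npq [_ xt] [_ xt']; have [//|x0] := eqVneq x 0; exfalso.
move: npq; have [|-> ->] := @root_comb_inj i j p q p' q' nij; last by rewrite eqxx.
move=> t Tt; apply: scalerI_neq0 (elimN eqP x0) _.
by rewrite -xt // xt'.
Qed.

Lemma wt_root i j p q x : i != j -> (p, q) != (0, 0) -> x <> 0 ->
  wt i j p q x -> is_root G T (root_comb i j p q).
Proof.
move=> nij npq x0 Wx; split; last by exists x.
apply: contrapT => trivial_comb.
have [|p0 q0] := @root_comb_inj i j p q 0 0 nij; last by rewrite p0 q0 in npq.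
move=> t Tt; rewrite {2}/root_comb !expr0z mulr1; apply: contrapT => chi1.
by apply: trivial_comb; exists t.
Qed.

Lemma wt_root_sign i j p q x : i != j -> (p, q) != (0, 0) -> x <> 0 ->
  wt i j p q x ->
  (is_pos_root G B T (root_comb i j p q) /\ 0 <= p /\ 0 <= q) \/
  (~ is_pos_root G B T (root_comb i j p q) /\ p <= 0 /\ q <= 0).
Proof.
move=> nij npq x0 Wx; have [_ _ span] := sroot_simple.
have [c /(root_comb_indep nij)[<- <-] sgn] := span _ (wt_root nij npq x0 Wx).
by case: sgn => -[pos c0]; [left|right].
Qed.

Lemma wt_mixed i j p q x : i != j -> 0 < p -> q < 0 -> wt i j p q x -> x = 0.
Proof.
move=> nij p0 q0 Wx; have [//|/eqP x0] := eqVneq x 0.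
have npq : (p, q) != (0, 0) by rewrite xpair_eqE gt_eqF.
have [[_ [_]]|[_ []]] := wt_root_sign nij npq x0 Wx.
  by rewrite leNgt q0.
by rewrite leNgt p0.
Qed.

(* Root spaces are lines, so a negative root space meets Lie B trivially. *)
Lemma wt_neg_not_borel i j p q x y : i != j -> (p, q) != (0, 0) ->
  0 <= p -> 0 <= q -> x <> 0 -> wt i j p q x ->
  wt i j (- p) (- q) y -> lie_alg B y -> y = 0.
Proof.
move=> nij npq p0 q0 x0 Wx Wy By; have [//|y0] := eqVneq y 0; exfalso.
have inv_comb : eq_char T (root_comb i j (- p) (- q)) (inv_char (root_comb i j p q)).
  by move=> t Tt; rewrite /inv_char /root_comb -!invr_expz invfM.
have npqN : (- p, - q) != (0, 0) by move: npq; rewrite !xpair_eqE !oppr_eq0.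
have contra : (p <= 0 /\ q <= 0) -> False.
  by move=> [p0' q0']; move: npq; rewrite xpair_eqE !eq_le p0 q0 p0' q0'.
have posx : is_pos_root G B T (root_comb i j p q).
  by have [[]//|[_ /contra]] := wt_root_sign nij npq x0 Wx.
have [[_]|[nposy _]] := wt_root_sign nij npqN (elimN eqP y0) Wy.
  by rewrite !oppr_ge0 => /contra.
have [_ _ _ _ [_ [_ /(_ _ posx)[k kE] _ lines _] _]] := hD.
have WE : wt i j (- p) (- q) `<=` range (fun c => c *: fvec k).
  case: (lines k) => _ <- z [Lz zt]; split=> // t Tt.
  by rewrite zt // inv_comb // /inv_char kE.
case: nposy; split; first exact: wt_root nij npqN (elimN eqP y0) Wy.
have [c _ yc] := WE _ Wy.
have c0 : c != 0 by apply: contraNneq y0 => c0; rewrite -yc c0 scale0r.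
move=> z /WE[d _ <-]; rewrite -(mulfVK c0 d) -scalerA yc.
exact: lie_algZ.
Qed.

End Weights.

(** * Commutation and braid relations in rank two *)

Section RankTwo.
Variables (C : numClosedFieldType) (I : finType) (n : nat) (D : group_data C I n).
Hypothesis hD : is_pinned_simply_laced_group D.
Implicit Types (i j : I) (t x y v : 'M[C]_n) (a b c z : C).

Local Notation G := (gr D).
Local Notation B := (bor D).
Local Notation T := (tor D).
Local Notation X := (xroot D).
Local Notation Y := (yroot D).
Local Notation E := (eroot D).
Local Notation F := (froot D).
Local Notation S := (weyl_rep D).
Local Notation alpha := (sroot D).

Lemma adjacentC i j : adjacent D i j -> adjacent D j i.
Proof. by case=> nij aij aji; split=> // /esym. Qed.

Lemma non_adjacentC i j : non_adjacent D i j -> non_adjacent D j i.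
Proof. by case=> nij aij aji; split=> // /esym. Qed.

Lemma bracket_EF i j : i != j -> lie_bracket (E i) (F j) = 0.
Proof.
move=> nij; apply: (wt_mixed hD nij _ _ (wt_bracket_eroot hD (wt_froot_r hD i j))) => //.
Qed.

Lemma bracket_FE i j : i != j -> lie_bracket (F i) (E j) = 0.
Proof. by move=> nij; rewrite bracketC bracket_EF ?oppr0 // eq_sym. Qed.

(** * Orthogonal simple roots *)

(** The reflection s_i sends alpha_i + alpha_j to - alpha_i + alpha_j, whose coefficients have
    opposite signs; [wtC] brings the positive one to the front. *)
Lemma bracket_EE_non_adjacent i j : non_adjacent D i j -> lie_bracket (E i) (E j) = 0.
Proof.
move=> [/eqP nij aij _]; have K := wt_bracket_eroot hD (wt_eroot_r hD i j).
have := wt_weyl hD K; rewrite aij => /(wtC (D := D)) sK.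
by apply: (adj_eq0 (weyl_unit hD i)); apply: (wt_mixed hD _ _ _ sK); rewrite // eq_sym.
Qed.

Lemma bracket_FF_non_adjacent i j : non_adjacent D i j -> lie_bracket (F i) (F j) = 0.
Proof.
move=> [/eqP nij aij _]; have K := wt_bracket_froot hD (wt_froot_r hD i j).
have := wt_weyl hD K; rewrite aij => sK.
by apply: (adj_eq0 (weyl_unit hD i)); apply: (wt_mixed hD _ _ _ sK).
Qed.

(** Each braid matrix is a word in the root subgroups of its letter, and all four pairs of root
    subgroups for [i] and [j] commute. *)
Lemma braid_mx_comm i j a b : non_adjacent D i j ->
  braid_mx D i a *m braid_mx D j b = braid_mx D j b *m braid_mx D i a.
Proof.
move=> na; have [/eqP nij _ _] := na.
have [XEi YFi] := (xroot_one_param hD i, yroot_one_param hD i).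
have [XEj YFj] := (xroot_one_param hD j, yroot_one_param hD j).
have cXX z z' := one_param_comm z z' XEi XEj (bracket_EE_non_adjacent na).
have cXY z z' := one_param_comm z z' XEi YFj (bracket_EF nij).
have cYX z z' := one_param_comm z z' YFi XEj (bracket_FE nij).
have cYY z z' := one_param_comm z z' YFi YFj (bracket_FF_non_adjacent na).
have comm3 (u u' v v' w : 'M[C]_n) : u *m w = w *m u -> v *m w = w *m v ->
    u *m v *m w = w *m (u *m v).
  by move=> uw vw; rewrite -mulmxA vw !mulmxA uw.
have cSg g : (forall z, X i z *m g = g *m X i z) -> (forall z, Y i z *m g = g *m Y i z) ->
    S i *m g = g *m S i.
  by move=> cX cY; rewrite (weyl_ULU hD); do 2! apply: (comm3) => //.
have cB g : (forall z, X i z *m g = g *m X i z) -> (forall z, Y i z *m g = g *m Y i z) ->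
    braid_mx D i a *m g = g *m braid_mx D i a.
  by move=> cX cY; rewrite /braid_mx -/(X i a); apply: (comm3) => //; apply: cSg.
apply: cB => z; rewrite /braid_mx (weyl_ULU hD) -/(X j b) !mulmxA.
  by rewrite cXX -!mulmxA (mulmxA (X i z)) cXX -!mulmxA (mulmxA (X i z)) cXY -!mulmxA cXX.
by rewrite cYX -!mulmxA (mulmxA (Y i z)) cYX -!mulmxA (mulmxA (Y i z)) cYY -!mulmxA cYX.
Qed.

Lemma adj_weyl_F_non_adjacent i j : non_adjacent D i j -> adj (S i) (F j) = F j.
Proof.
move=> na; have [/eqP nij _ _] := na.
have [XE YF] := (xroot_one_param hD i, yroot_one_param hD i).
rewrite (adj_weyl_ULU hD) (one_param_adj_fixed XE _ (bracket_EF nij)).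
rewrite (one_param_adj_fixed YF _ (bracket_FF_non_adjacent na)).
by rewrite (one_param_adj_fixed XE _ (bracket_EF nij)).
Qed.

(** * Simple roots spanning a root system of type A2 *)

(** With a_ij = -1, the weight 2 alpha_i + alpha_j is reflected to - alpha_i + alpha_j, again of
    mixed sign. *)
Lemma serre_E i j : adjacent D i j -> lie_bracket (E i) (lie_bracket (E i) (E j)) = 0.
Proof.
move=> [/eqP nij aij _].
have := wt_bracket_eroot hD (wt_bracket_eroot hD (wt_eroot_r hD i j)).
move=> /(wt_weyl hD); rewrite aij => /(wtC (D := D)) sK.
by apply: (adj_eq0 (weyl_unit hD i)); apply: (wt_mixed hD _ _ _ sK); rewrite // eq_sym.
Qed.

Lemma serre_F i j : adjacent D i j -> lie_bracket (F i) (lie_bracket (F i) (F j)) = 0.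
Proof.
move=> [/eqP nij aij _].
have := wt_bracket_froot hD (wt_bracket_froot hD (wt_froot_r hD i j)).
move=> /(wt_weyl hD); rewrite aij => sK.
by apply: (adj_eq0 (weyl_unit hD i)); apply: (wt_mixed hD _ _ _ sK).
Qed.

(* Ad(s_i) E_j has weight alpha_i + alpha_j; its component of weight alpha_j
   computed from s_i = y_i(1) x_i(-1) y_i(1) must therefore vanish. *)
Lemma adj_weyl_E_aux i j : adjacent D i j ->
  lie_bracket (F i) (lie_bracket (E i) (E j)) = E j /\
  adj (S i) (E j) = - lie_bracket (E i) (E j).
Proof.
move=> ad; have [/eqP nij aij _] := ad.
have Ej := wt_eroot_r hD i j.
set K := lie_bracket (E i) (E j); have WK : wt D i j 1 1 K := wt_bracket_eroot hD Ej.
set L := lie_bracket (F i) K; have WL : wt D i j 0 1 L := wt_bracket_froot hD WK.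
have FL : lie_bracket (F i) L = 0.
  have nji : j != i by rewrite eq_sym.
  by apply: (wt_mixed hD nji _ _ (wtC (wt_bracket_froot hD WL))).
have sE : adj (S i) (E j) = E j - K - L.
  have [XE YF] := (xroot_one_param hD i, yroot_one_param hD i).
  rewrite (adj_weyl_LUL hD) (one_param_adj_fixed YF _ (bracket_FE nij)).
  rewrite (one_param_adj_affine XE) ?serre_E // scaleN1r -/K adjB.
  rewrite (one_param_adj_fixed YF _ (bracket_FE nij)).
  by rewrite (one_param_adj_affine YF) // scale1r opprD addrA.
have WsE : wt D i j 1 1 (adj (S i) (E j)).
  by have := wt_weyl hD Ej; rewrite aij.
have EL : E j - L = 0.
  apply: (@wt_disjoint _ _ _ _ hD i j 0 1 1 1) => //.
    by apply: wtD => //; apply: wtN.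
  suff -> : E j - L = adj (S i) (E j) + K by apply: wtD.
  by rewrite sE addrAC subrK.
move/eqP: (EL); rewrite subr_eq0 => /eqP e; split=> //.
by rewrite sE addrAC EL add0r.
Qed.

Lemma adj_weyl_E i j : adjacent D i j -> adj (S i) (E j) = - lie_bracket (E i) (E j).
Proof. by move=> /adj_weyl_E_aux[]. Qed.

Lemma bracket_FEE i j : adjacent D i j ->
  lie_bracket (F i) (lie_bracket (E i) (E j)) = E j.
Proof. by move=> /adj_weyl_E_aux[]. Qed.

(** From s_i = x_i(-1) y_i(1) x_i(-1) one gets Ad(s_i) F_j = F_j + K - L. This has weight - alpha_i
    - alpha_j, so the part F_j - L of weight - alpha_j must vanish. *)
Lemma adj_weyl_F_aux i j : adjacent D i j ->
  lie_bracket (E i) (lie_bracket (F i) (F j)) = F j /\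
  adj (S i) (F j) = lie_bracket (F i) (F j).
Proof.
move=> ad; have [/eqP nij aij _] := ad.
have Fj := wt_froot_r hD i j.
set K := lie_bracket (F i) (F j).
have WK : wt D i j (-1) (-1) K := wt_bracket_froot hD Fj.
set L := lie_bracket (E i) K; have WL : wt D i j 0 (-1) L := wt_bracket_eroot hD WK.
have EL : lie_bracket (E i) L = 0.
  by apply: (wt_mixed hD nij _ _ (wt_bracket_eroot hD WL)).
have sF : adj (S i) (F j) = F j + K - L.
  have [XE YF] := (xroot_one_param hD i, yroot_one_param hD i).
  rewrite (adj_weyl_ULU hD) (one_param_adj_fixed XE _ (bracket_EF nij)).
  rewrite (one_param_adj_affine YF) ?serre_F // scale1r -/K adjD.
  rewrite (one_param_adj_fixed XE _ (bracket_EF nij)).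
  by rewrite (one_param_adj_affine XE) // scaleN1r addrA.
have WsF : wt D i j (-1) (-1) (adj (S i) (F j)).
  by have := wt_weyl hD Fj; rewrite aij.
have FL : F j - L = 0.
  apply: (@wt_disjoint _ _ _ _ hD i j 0 (-1) (-1) (-1)) => //.
    by apply: wtD => //; apply: wtN.
  suff -> : F j - L = adj (S i) (F j) - K by apply: wtD => //; apply: wtN.
  by rewrite sF addrAC addrK.
move/eqP: (FL); rewrite subr_eq0 => /eqP e; split=> //.
by rewrite sF addrAC FL add0r.
Qed.

Lemma adj_weyl_F i j : adjacent D i j -> adj (S i) (F j) = lie_bracket (F i) (F j).
Proof. by move=> /adj_weyl_F_aux[]. Qed.

Lemma bracket_EFF i j : adjacent D i j ->
  lie_bracket (E i) (lie_bracket (F i) (F j)) = F j.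
Proof. by move=> /adj_weyl_F_aux[]. Qed.

(** In type A2, s_i s_j alpha_i = alpha_j, so the image is a multiple of E_j; the computation shows
    that the scalar is exactly 1. *)
Lemma adj_weyl2_E i j : adjacent D i j -> adj (S i *m S j) (E i) = E j.
Proof.
move=> ad; have [/eqP nij _ _] := ad; have uS := weyl_unit hD.
have [XE YF] := (xroot_one_param hD i, yroot_one_param hD i).
rewrite -adj_comp // (adj_weyl_E (adjacentC ad)) -bracketC (adj_weyl_ULU hD).
rewrite (one_param_adj_fixed XE _ (serre_E ad)) (one_param_adj_affine YF); last first.
  by rewrite bracket_FEE // bracket_FE.
rewrite bracket_FEE // scale1r adjD (one_param_adj_fixed XE _ (serre_E ad)).
by rewrite (one_param_adj_affine XE) ?serre_E // scaleN1r addrC subrK.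
Qed.

Lemma adj_weyl2_F i j : adjacent D i j -> adj (S i *m S j) (F i) = F j.
Proof.
move=> ad; have [/eqP nij _ _] := ad; have uS := weyl_unit hD.
have [XE YF] := (xroot_one_param hD i, yroot_one_param hD i).
rewrite -adj_comp // (adj_weyl_F (adjacentC ad)) bracketC adjN (adj_weyl_ULU hD).
have EEL : lie_bracket (E i) (lie_bracket (E i) (lie_bracket (F i) (F j))) = 0.
  by rewrite bracket_EFF // bracket_EF.
rewrite (one_param_adj_affine XE _ EEL) bracket_EFF // scaleN1r adjB.
rewrite (one_param_adj_fixed YF _ (serre_F ad)) (one_param_adj_affine YF); last first.
  exact: serre_F.
rewrite scale1r opprD addrCA subrr addr0 adjN opprK.
by rewrite (one_param_adj_fixed XE _ (bracket_EF nij)).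
Qed.

Lemma weyl2_conj i j : adjacent D i j ->
  (forall z, adj (S i *m S j) (X i z) = X j z) /\
  (forall z, adj (S i *m S j) (Y i z) = Y j z).
Proof.
move=> ad; have uSS := mulmx_unit (weyl_unit hD i) (weyl_unit hD j).
have [XEi YFi] := (xroot_one_param hD i, yroot_one_param hD i).
split; [move: (one_param_adj XEi uSS)|move: (one_param_adj YFi uSS)].
  by rewrite adj_weyl2_E // => /one_param_uniq; apply; apply: xroot_one_param.
by rewrite adj_weyl2_F // => /one_param_uniq; apply; apply: yroot_one_param.
Qed.

(** Conjugation by s_i s_j carries x_i and y_i to x_j and y_j, hence carries s_i, a word in them, to
    s_j. *)
Lemma weyl_braid i j : adjacent D i j -> S i *m S j *m S i = S j *m S i *m S j.
Proof.
move=> ad; have uSS := mulmx_unit (weyl_unit hD i) (weyl_unit hD j).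
have [cX cY] := weyl2_conj ad.
have : adj (S i *m S j) (S i) = S j.
  by rewrite [X in adj _ X](weyl_ULU hD i) !adjM // !cX cY -(weyl_ULU hD).
by move=> e; rewrite -[RHS]mulmxA -[X in _ = X *m _]e /adj mulmxKV.
Qed.

(** Once the Weyl representatives are moved to the right, where they agree by the braid relation, an
    identity remains in the Heisenberg group generated by x_i, x_j and the root subgroup [Z] of
    alpha_i + alpha_j. *)
Lemma braid_relation i j z1 z2 z3 : adjacent D i j ->
  braid_mx D i z1 *m braid_mx D j z2 *m braid_mx D i z3 =
  braid_mx D j z3 *m braid_mx D i (z1 * z3 - z2) *m braid_mx D j z1.
Proof.
move=> ad; have [uSi uSj] := (weyl_unit hD i, weyl_unit hD j).
have [XEi XEj] := (xroot_one_param hD i, xroot_one_param hD j).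
set K := lie_bracket (E i) (E j).
pose Z a := adj (S i) (X j a).
have ZK : one_param Z (- K) by rewrite -(adj_weyl_E ad); apply: one_param_adj.
have ZE a : adj (S i) (X j a) = Z a by [].
clearbody Z.
(* The generator of [Z] is - [E_i, E_j], whereas Ad(s_j) E_i = - [E_j, E_i] = [E_i, E_j]; hence the
   reversed parameter. *)
have Z'K a : adj (S j) (X i a) = Z (- a).
  have ZK' : one_param (fun a => Z (-1 * a)) K.
    by have := one_param_rescale ZK (-1); rewrite scaleN1r opprK.
  have := one_param_adj XEi uSj; rewrite (adj_weyl_E (adjacentC ad)) -bracketC => XK.
  by rewrite -mulN1r (one_param_uniq XK ZK').
have EiK : lie_bracket (E i) (- K) = 0 by rewrite bracketNr (serre_E ad) oppr0.
have EjK : lie_bracket (E j) (- K) = 0.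
  by rewrite bracketNr /K (bracketC (E i)) bracketNr (serre_E (adjacentC ad)) !oppr0.
(* The Heisenberg commutator: conjugation by [X i a] adds a multiple of [E_i, E_j] to E_j. It
   produces the term z1 z3 of the middle coordinate. *)
have commX a c : X i a *m X j c = X j c *m Z (- (a * c)) *m X i a.
  have ua := one_param_unit XEi a.
  have gen : adj (X i a) (E j) = E j + - a *: - K.
    by rewrite (one_param_adj_affine XEi a (serre_E ad)) scaleNr scalerN opprK.
  have EjaK : lie_bracket (E j) (- a *: - K) = 0 by rewrite bracketZr EjK scaler0.
  have := one_param_adj XEj ua; rewrite gen => XEa.
  have /(one_param_uniq XEa)/(_ c) := one_param_mul XEj (one_param_rescale ZK (- a)) EjaK.
  by rewrite mulNr => <-; rewrite /adj mulmxKV.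
(* The third unipotent factor crosses s_i s_j and becomes one for the other root; the second crosses
   a single representative and lands in the root subgroup of the sum. *)
have push i' j' a b c : adjacent D i' j' ->
    braid_mx D i' a *m braid_mx D j' b *m braid_mx D i' c =
    X i' a *m adj (S i') (X j' b) *m X j' c *m (S i' *m S j' *m S i').
  move=> ad'; have [cX _] := weyl2_conj ad'.
  have [uS uS'] := (weyl_unit hD i', weyl_unit hD j').
  rewrite -(cX c) /braid_mx -/(X i' a) -/(X j' b) -/(X i' c) /adj invmxM //.
  by rewrite !mulmxA !(mulmxKV uS) !(mulmxKV uS').
rewrite !push //; last exact: adjacentC.
rewrite (weyl_braid ad) Z'K ZE opprB; congr (_ *m _).
rewrite (one_param_comm z1 z2 XEi ZK EiK) -mulmxA commX !mulmxA.
rewrite -(one_param_comm z3 z2 XEj ZK EjK); congr (_ *m _).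
by case: ZK => ? [_ _ ZD _]; rewrite ZD mulmxA.
Qed.

End RankTwo.

(** * Negative root directions modulo Lie B *)

Section Borel.
Variables (C : numClosedFieldType) (I : finType) (n : nat) (D : group_data C I n).
Hypothesis hD : is_pinned_simply_laced_group D.
Implicit Types (i j : I) (t x y v : 'M[C]_n) (a b c z : C).

Local Notation B := (bor D).
Local Notation T := (tor D).
Local Notation X := (xroot D).
Local Notation Y := (yroot D).
Local Notation E := (eroot D).
Local Notation F := (froot D).
Local Notation S := (weyl_rep D).
Local Notation braid := (braid_mx D).

Lemma wt_neg_l i j y : i != j -> wt D i j (-1) 0 y -> lie_alg B y -> y = 0.
Proof.
move=> nij Wy; have := @wt_neg_not_borel _ _ _ _ hD i j 1 0 (E i) y nij.
by rewrite oppr0; apply=> //; [exact: (eroot_neq0 hD (i := i))|exact: wt_eroot_l].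
Qed.

Lemma wt_neg_r i j y : i != j -> wt D i j 0 (-1) y -> lie_alg B y -> y = 0.
Proof. by rewrite eq_sym => nji /wtC; apply: wt_neg_l. Qed.

Lemma wt_neg_lr i j y : adjacent D i j ->
  wt D i j (-1) (-1) y -> lie_alg B y -> y = 0.
Proof.
move=> [/eqP nij aij _]; move=> Wy.
apply: (@wt_neg_not_borel _ _ _ _ hD i j 1 1 (adj (S i) (E j)) y nij) => //.
  by move/(adj_eq0 (weyl_unit hD i))/(eroot_neq0 hD).
by have := wt_weyl hD (wt_eroot_r hD i j); rewrite aij.
Qed.

Lemma froot_not_borel i j : i != j -> ~ lie_alg B (F i).
Proof. by move=> nij /(wt_neg_l nij (wt_froot_l hD i j))/(froot_neq0 hD). Qed.

(** Torus conjugation rescales the parameter by arbitrary squares, that is, by every nonzero scalar.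
    One nontrivial point in B would put the whole subgroup in B, and with it F_i in Lie B. *)
Lemma yroot_borel i j z : i != j -> B (Y i z) -> z = 0.
Proof.
move=> nij BYz; have [//|z0] := eqVneq z 0.
case: (froot_not_borel nij); apply: one_param_lie_alg (yroot_one_param hD i) _ => a.
have [->|a0] := eqVneq a 0.
  by case: (yroot_one_param hD i) => ? [_ -> _ _]; case: (bor_subgroup hD).
(* Conjugation by h_i(s) divides the parameter by s^2, so it takes [z] to [a]. *)
pose s := sqrtC (z / a).
have s0 : s != 0 by rewrite sqrtC_eq0 mulf_neq0 ?invr_eq0.
have -> : a = (sroot D i (hroot D i s))^-1 * z.
  rewrite (sroot_hroot hD) // (cartan_diag hD) -exprnP sqrtCK invf_div.
  by rewrite mulfVK.
rewrite -(adj_yroot hD); last exact (hroot_tor hD i s0).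
by apply: (bor_adj_stable hD) => //; exact (tor_bor (hroot_tor hD i s0)).
Qed.

Lemma adj_invbraid i z v : adj (invmx (braid i z)) v = adj (invmx (S i)) (adj (X i (- z)) v).
Proof.
have [uX uS] := (one_param_unit (xroot_one_param hD i) z, weyl_unit hD i).
rewrite /braid_mx -/(X i z) invmxM // -adj_comp ?unitmx_inv //.
by rewrite (one_paramV (xroot_one_param hD i)).
Qed.

Lemma adj_invbraid_froot i j z : i != j ->
  adj (invmx (braid i z)) (F j) = adj (invmx (S i)) (F j).
Proof.
move=> nij; rewrite adj_invbraid.
by rewrite (one_param_adj_fixed (xroot_one_param hD i) _ (bracket_EF hD nij)).
Qed.

Lemma braid_unit i z : braid i z \in unitmx.
Proof.
by rewrite mulmx_unit ?(weyl_unit hD) // (one_param_unit (xroot_one_param hD i)).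
Qed.

(** The left logarithmic derivative of B_i is Ad(s_i^-1) E_i, independently of [z], because x_i
    commutes with its own generator. *)
Lemma invbraid_dbraid i z : invmx (braid i z) *m dbraid_mx D i z = - F i.
Proof.
have [uX uS] := (one_param_unit (xroot_one_param hD i) z, weyl_unit hD i).
rewrite /braid_mx /dbraid_mx (dphi_mxU hD) -/(X i z) invmxM // !mulmxA mulmxKV //.
by rewrite -(adj_invweyl_eroot hD) /adj invmxK.
Qed.

Lemma lie_algZK a x : a != 0 -> lie_alg B (a *: x) -> lie_alg B x.
Proof. by move=> a0 /(@lie_algZ _ _ _ a^-1); rewrite scalerA mulVf // scale1r. Qed.

Lemma adj_hroot_wt i j p q a x : a != 0 -> wt D i j p q x ->
  adj (hroot D i a) x = a ^ (2 * p + cartan D i j * q) *: x.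
Proof.
move=> a0 [_ xt]; rewrite xt; last exact (hroot_tor hD i a0).
by rewrite /root_comb !(sroot_hroot hD) // (cartan_diag hD) !exprz_exp expfzDr //.
Qed.

(** The operator Ad(t) - b preserves Lie B, kills [y] and multiplies [x] by the nonzero scalar a -
    b. *)
Lemma lie_bor_eigen2 t a b x y : T t -> a != b -> adj t x = a *: x -> adj t y = b *: y ->
  lie_alg B (x + y) -> lie_alg B x.
Proof.
move=> Tt nab tx ty Bxy; apply: (@lie_algZK (a - b)); first by rewrite subr_eq0.
have -> : (a - b) *: x = adj t (x + y) - b *: (x + y).
  by rewrite adjD tx ty scalerDr opprD addrACA subrr addr0 scalerBl.
apply: lie_algB; last exact: lie_algZ.
by apply: (lie_bor_adj hD) => //; apply: tor_bor.
Qed.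

Lemma lie_bor_eigen3 t a b c x y (z : 'M[C]_n) : T t -> a != b -> a != c ->
  adj t x = a *: x -> adj t y = b *: y -> adj t z = c *: z ->
  lie_alg B (x + y + z) -> lie_alg B x.
Proof.
move=> Tt nab nac tx ty tz Bxyz; apply: (@lie_algZK (a - c)); first by rewrite subr_eq0.
apply: (@lie_bor_eigen2 t a b _ ((b - c) *: y)) => //.
- by rewrite adjZ tx !scalerA mulrC.
- by rewrite adjZ ty !scalerA mulrC.
have -> : (a - c) *: x + (b - c) *: y = adj t (x + y + z) - c *: (x + y + z).
  rewrite !adjD tx ty tz !scalerDr !opprD !scalerBl.
  by rewrite [RHS]addrACA subrr addr0 [RHS]addrACA.
apply: lie_algB; last exact: lie_algZ.
by apply: (lie_bor_adj hD) => //; apply: tor_bor.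
Qed.

Lemma two_exprz_neq (m k : int) : m != k -> 2 ^ m != 2 ^ k :> C.
Proof. by apply: contraNneq => /two_exprz_inj->. Qed.

Lemma non_adjacent_tangents i j c0 c1 : non_adjacent D i j ->
  lie_alg B (c0 *: F i + c1 *: F j) -> c0 = 0 /\ c1 = 0.
Proof.
move=> [/eqP nij aij _] Bs; have two0 : 2 != 0 :> C by rewrite pnatr_eq0.
(* The element h_i(2) has eigenvalue 1/4 on F_i and 1 on F_j. *)
have Tt := hroot_tor hD i two0.
have [WFi WFj] := (wtZ c0 (wt_froot_l hD i j), wtZ c1 (wt_froot_r hD i j)).
have [tFi tFj] := (adj_hroot_wt two0 WFi, adj_hroot_wt two0 WFj); rewrite aij in tFi tFj.
have Bi : lie_alg B (c0 *: F i).
  by apply: lie_bor_eigen2 Tt _ tFi tFj Bs; apply: two_exprz_neq.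
have Bj : lie_alg B (c1 *: F j).
  by move: Bs; rewrite addrC; apply: lie_bor_eigen2 Tt _ tFj tFi; apply: two_exprz_neq.
move: (wt_neg_l nij WFi Bi) (wt_neg_r nij WFj Bj) => /eqP + /eqP.
rewrite !scaler_eq0 => /orP[/eqP->|/eqP/(froot_neq0 hD)//].
by case/orP=> [/eqP->|/eqP/(froot_neq0 hD)].
Qed.

(** The three vectors form a triangular system along the roots - alpha_j, - alpha_i - alpha_j, -
    alpha_i: only the first meets the first root space, and its extra term lies in the second. *)
Lemma adjacent_tangents i j b c c0 c1 c2 : adjacent D i j ->
  lie_alg B (c0 *: adj (invmx (braid i c)) (adj (invmx (braid j b)) (F i))
    + c1 *: adj (invmx (braid i c)) (F j) + c2 *: F i) ->
  [/\ c0 = 0, c1 = 0 & c2 = 0].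
Proof.
move=> ad; have [/eqP nij aij aji] := ad; have two0 : 2 != 0 :> C by rewrite pnatr_eq0.
have nji : j != i by rewrite eq_sym.
have uSV k : invmx (S k) \in unitmx by rewrite unitmx_inv (weyl_unit hD).
rewrite (adj_invbraid_froot _ nji) (adj_invbraid_froot _ nij) adj_invbraid.
set N := adj (invmx (S j)) (F i).
have WN : wt D i j (-1) (-1) N.
  by have /wtC := wt_invweyl hD (wt_froot_r hD j i); rewrite aji.
(* [N] has weight - alpha_i - alpha_j, so two brackets with E_i lead to the mixed weight alpha_i -
   alpha_j and Ad(x_i) is affine on [N]. *)
have EEN : lie_bracket (E i) (lie_bracket (E i) N) = 0.
  by apply: (wt_mixed hD nij _ _ (wt_bracket_eroot hD (wt_bracket_eroot hD WN))).
rewrite (one_param_adj_affine (xroot_one_param hD i) _ EEN) adjD adjZ.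
set N' := adj _ N; set M := adj _ (lie_bracket _ _); set L := adj _ (F j).
have WN' : wt D i j 0 (-1) N' by have := wt_invweyl hD WN; rewrite aij.
have WM : wt D i j (-1) (-1) M.
  by have := wt_invweyl hD (wt_bracket_eroot hD WN); rewrite aij.
have WL : wt D i j (-1) (-1) L by have := wt_invweyl hD (wt_froot_r hD i j); rewrite aij.
have -> : c0 *: (N' + - c *: M) + c1 *: L + c2 *: F i =
    c0 *: N' + ((c0 * - c) *: M + c1 *: L) + c2 *: F i.
  by rewrite scalerDr scalerA addrA.
move=> Bs; have Tt := hroot_tor hD i two0.
have W0 := wtZ c0 WN'; have W1 := wtP (c0 * - c) WM (wtZ c1 WL).
have W2 := wtZ c2 (wt_froot_l hD i j).
(* The eigenvalues of h_i(2) on the three components are 2, 1/2 and 1/4. *)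
have := (adj_hroot_wt two0 W0, adj_hroot_wt two0 W1, adj_hroot_wt two0 W2).
rewrite aij => -[[t0 t1] t2].
have c00 : c0 = 0.
  have B0 : lie_alg B (c0 *: N').
    by apply: lie_bor_eigen3 Tt _ _ t0 t1 t2 Bs; apply: two_exprz_neq.
  have /eqP := wt_neg_r nij W0 B0; rewrite scaler_eq0 => /orP[/eqP//|/eqP].
  by move=> /(adj_eq0 (uSV i))/(adj_eq0 (uSV j))/(froot_neq0 hD).
move: Bs t1 W1; rewrite c00 scale0r mul0r scale0r !add0r => Bs t1 W1.
have B1 : lie_alg B (c1 *: L).
  by apply: lie_bor_eigen2 Tt _ t1 t2 Bs; apply: two_exprz_neq.
have B2 : lie_alg B (c2 *: F i).
  by move: Bs; rewrite addrC; apply: lie_bor_eigen2 Tt _ t2 t1; apply: two_exprz_neq.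
move: (wt_neg_lr ad W1 B1) (wt_neg_l nij W2 B2) => /eqP + /eqP; rewrite !scaler_eq0.
move=> /orP[/eqP->|/eqP/(adj_eq0 (uSV i))/(froot_neq0 hD)//].
by case/orP=> [/eqP->|/eqP/(froot_neq0 hD)].
Qed.

End Borel.

(** * Ordered products and the Leibniz rule *)

Section OrderedProducts.
Variables (R : comUnitRingType) (n l : nat).
Implicit Types (p v : 'I_l -> 'M[R]_n) (k : nat).

(** The default value is the identity, so that partial products are indexed by naturals and can be
    split at any position. *)
Definition ext_point p k : 'M[R]_n := if insub k is Some k' then p k' else 1%:M.

Definition lprod p k : 'M[R]_n := \prod_(0 <= m < k) ext_point p m.
Definition rprod p k : 'M[R]_n := \prod_(k <= m < l) ext_point p m.

Lemma ext_pointE p (k : 'I_l) : ext_point p k = p k.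
Proof. by rewrite /ext_point valK. Qed.

Lemma lprodS p (k : 'I_l) : lprod p k.+1 = lprod p k *m p k.
Proof. by rewrite /lprod big_nat_recr //= ext_pointE. Qed.

Lemma rprodS p (k : 'I_l) : rprod p k = p k *m rprod p k.+1.
Proof. by rewrite /rprod big_ltn // ext_pointE. Qed.

Lemma lprod0 p : lprod p 0 = 1%:M.
Proof. by rewrite /lprod big_geq. Qed.

Lemma rprod_size p : rprod p l = 1%:M.
Proof. by rewrite /rprod big_geq. Qed.

Lemma lprod_rprod p k : (k <= l)%N -> lprod p k *m rprod p k = lprod p l.
Proof. by move=> kl; rewrite [RHS](big_cat_nat (n := k)). Qed.

Lemma lprodE p : lprod p l = \prod_(k < l) p k.
Proof. by rewrite /lprod big_mkord; apply: eq_bigr => k _; rewrite ext_pointE. Qed.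

Lemma lprod_unit p k : (forall k' : 'I_l, p k' \in unitmx) -> lprod p k \in unitmx.
Proof.
move=> up; rewrite /lprod; elim/big_ind: _ => [|g h ug uh|m _]; first exact: unitmx1.
  by rewrite [_ \in _]unitmx_mul ug.
by rewrite /ext_point; case: insub => [k'|]; rewrite ?unitmx1.
Qed.

(** A summand of the Leibniz rule: the factor at [k] is replaced, so the right part begins at
    [k.+1]. *)
Definition insert_at p v (k : 'I_l) : 'M[R]_n := lprod p k *m v k *m rprod p k.+1.

End OrderedProducts.

Section Leibniz.
Variables (C : numClosedFieldType) (n l : nat).
Implicit Types (A : 'I_l -> 'M[{poly C}]_n).

Lemma mxhorner_prod (r : seq nat) (A : nat -> 'M[{poly C}]_n) a :
  mxhorner (\prod_(m <- r) A m) a = \prod_(m <- r) mxhorner (A m) a.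
Proof.
elim: r => [|m r IH]; first by rewrite !big_nil /mxhorner map_mx1.
by rewrite !big_cons mxhornerM IH.
Qed.

Lemma mxhorner_ext A k a : mxhorner (ext_point A k) a =
  ext_point (fun k' => mxhorner (A k') a) k.
Proof. by rewrite /ext_point; case: insub => // ; rewrite /mxhorner map_mx1. Qed.

Lemma mxhorner_lprod A k a : mxhorner (lprod A k) a = lprod (fun k' => mxhorner (A k') a) k.
Proof. by rewrite mxhorner_prod; apply: eq_bigr => m _; rewrite mxhorner_ext. Qed.

Lemma mxhorner_rprod A k a : mxhorner (rprod A k) a = rprod (fun k' => mxhorner (A k') a) k.
Proof. by rewrite mxhorner_prod; apply: eq_bigr => m _; rewrite mxhorner_ext. Qed.

Lemma mxderiv1 : mxderiv (1%:M : 'M[{poly C}]_n) = 0.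
Proof. by apply/matrixP=> i j; rewrite !mxE; case: eqP => _; rewrite derivC. Qed.

Lemma mxderiv_prod (A : nat -> 'M[{poly C}]_n) N :
  mxderiv (\prod_(0 <= m < N) A m) =
  \sum_(0 <= k < N) (\prod_(0 <= m < k) A m) *m mxderiv (A k) *m
                    (\prod_(k.+1 <= m < N) A m).
Proof.
elim: N => [|N IH]; first by rewrite !big_geq // mxderiv1.
rewrite big_nat_recr //= mxderivM IH big_nat_recr //=.
have -> : \prod_(N.+1 <= m < N.+1) A m = 1%:M by rewrite big_geq.
rewrite mulmx1.
congr (_ + _); rewrite mulmx_suml !big_nat; apply: eq_bigr => k /andP[_ kN].
by rewrite -mulmxA [in RHS]big_nat_recr.
Qed.

Lemma mxderiv_lprod A :
  mxderiv (lprod A l) = \sum_k insert_at A (fun k' => mxderiv (A k')) k.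
Proof.
rewrite /lprod mxderiv_prod big_mkord; apply: eq_bigr => k _.
by rewrite /insert_at ext_pointE.
Qed.

Lemma mxhorner_insert_at A (V : 'I_l -> 'M[{poly C}]_n) k a :
  mxhorner (insert_at A V k) a =
  insert_at (fun k' => mxhorner (A k') a) (fun k' => mxhorner (V k') a) k.
Proof. by rewrite !mxhornerM mxhorner_lprod mxhorner_rprod. Qed.

End Leibniz.

(** * Multiplying the factors: covectors and bivectors *)

Section PoissonProduct.
Variables (C : numClosedFieldType) (I : finType) (n : nat) (D : group_data C I n).
Variable l : nat.
Local Notation point := ('I_l -> 'M[C]_n).
Implicit Types (p v x xi : point) (eta zeta : 'M[C]_n).

(* Along the map p |-> p_0 ... p_{l-1}. *)
Definition pullback p eta : point := fun k => rprod p k.+1 *m eta *m lprod p k.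

Lemma mxtrace_pullback p eta (k : 'I_l) (y : 'M[C]_n) :
  \tr (pullback p eta k *m y) = \tr (eta *m (lprod p k *m y *m rprod p k.+1)).
Proof. by rewrite /pullback -!mulmxA mxtrace_mulC !mulmxA. Qed.

Lemma sum_telescope (f : 'I_l -> C) (A : nat -> C) :
  (forall k : 'I_l, f k = A k.+1 - A k) -> \sum_k f k = A l - A 0%N.
Proof.
by move=> fA; rewrite -(telescope_sumr A (leq0n l)) big_mkord; apply: eq_bigr.
Qed.

(** Along an orbit the inner factors b_k cancel in the product, and only the last one moves it, by
    right multiplication. Infinitesimally the pairing telescopes to a single term, which [eta]
    kills. *)
Lemma pullback_conormal p eta :
  (forall y, lie_alg (bor D) y -> \tr (eta *m (lprod p l *m y)) = 0) ->
  conormal D p (pullback p eta).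
Proof.
move=> Heta x Bx.
(* [y] is [x] shifted by one place, with 0 in front as in [prev]; the term at 0 then vanishes and
   the term at [l] is the last direction in Lie B. *)
pose y k := if k is k'.+1 then if (insub k' : option 'I_l) is Some k'' then x k'' else 0 else 0.
pose A k := \tr (eta *m (lprod p k *m y k *m rprod p k)).
rewrite /pairing (sum_telescope (A := A)) => [|k].
  rewrite /A rprod_size mulmx1 /= mulmx0 mul0mx mulmx0 mxtrace0.
  rewrite Heta ?subrr // /y; case: {1}l => [|l']; first exact: lie_alg0.
  by case: insub => [k|]; [exact: Bx|exact: lie_alg0].
have yk1 : y k.+1 = x k by rewrite /y /= valK.
have yk : y k = prev 0 x k.
  rewrite /y /prev; case: k {yk1} => -[|k] /= kl //.
  (* [ord_pred] is cyclic; away from 0 it is the ordinary predecessor. *)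
  have kl' : (k < l)%N by apply: ltnW.
  rewrite (insubT (fun m => m < l)%N kl') /=; congr (x _); apply: val_inj => /=.
  by rewrite modnDr modn_small.
rewrite mxtrace_pullback /orbit_tangent /A lprodS yk1 yk [rprod p k]rprodS.
by rewrite mulmxBr mulmxBl mulmxBr raddfB /= !mulmxA.
Qed.

(* pi_st is a difference of left and right translates, hence multiplicative;
   along the word the sum telescopes. *)
Lemma pi_prod_pullback p eta zeta :
  pi_prod D p (pullback p eta) (pullback p zeta) = pi_st D (lprod p l) eta zeta.
Proof.
pose A k : C := \sum_(a < npos D) sqlen a / 2 *
  wedge (lprod p k *m fvec a *m rprod p k) (lprod p k *m evec a *m rprod p k) eta zeta.
rewrite /pi_prod (sum_telescope (A := A)) => [|k].
  rewrite /A /pi_st -sumrB; apply: eq_bigr => a _; rewrite -mulrBr.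
  by rewrite rprod_size !mulmx1 lprod0 !mul1mx -[rprod p 0]mul1mx -(lprod0 p) lprod_rprod.
rewrite /A /pi_st -sumrB; apply: eq_bigr => a _; rewrite -mulrBr /wedge.
by rewrite !mxtrace_pullback !lprodS [rprod p k]rprodS !mulmxA.
Qed.

End PoissonProduct.

(** * Tangent vectors and bivectors on cells *)

Section CellTangents.
Variables (C : numClosedFieldType) (I : finType) (n : nat) (D : group_data C I n).
Hypothesis hD : is_pinned_simply_laced_group D.

Definition cell_mx l (w : l.-tuple I) (z : l.-tuple C) : 'M[C]_n :=
  lprod (braid_point D w z) l.

Definition cell_tangent l (w : l.-tuple I) (z : l.-tuple C) : 'I_l -> 'M[C]_n :=
  insert_at (braid_point D w z) (fun k => dbraid_mx D (tnth w k) (tnth z k)).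

Lemma cell_mx_unit l (w : l.-tuple I) z : cell_mx w z \in unitmx.
Proof. by apply: lprod_unit => k; apply: braid_unit. Qed.

(** Translation to the identity cancels the factors before position [k]; those after it remain as a
    conjugation of the logarithmic derivative - F. *)
Lemma cell_tangent_left l (w : l.-tuple I) z k :
  invmx (cell_mx w z) *m cell_tangent w z k =
  - adj (invmx (rprod (braid_point D w z) k.+1)) (froot D (tnth w k)).
Proof.
set p := braid_point D w z.
have up k' : p k' \in unitmx by apply: braid_unit.
have uL : lprod p k \in unitmx by apply: lprod_unit.
have ug : lprod p k *m p k *m rprod p k.+1 = cell_mx w z.
  by rewrite -mulmxA -rprodS lprod_rprod // ltnW.
have uR : rprod p k.+1 \in unitmx.
  by have := cell_mx_unit w z; rewrite -ug unitmx_mul => /andP[].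
rewrite -ug invmxM ?(mulmx_unit uL (up k)) // invmxM // /cell_tangent /insert_at -/p.
rewrite !mulmxA mulmxKV //.
by rewrite -adjN -(invbraid_dbraid hD _ (tnth z k)) /adj invmxK !mulmxA.
Qed.

Section Curve.
Variables (l : nat) (w : l.-tuple I) (q : 'I_l -> {poly C}).

(** The braid matrix along a polynomial curve of coordinates, kept as a matrix of polynomials so
    that it can be differentiated formally. *)
Definition braid_curve k : 'M[{poly C}]_n :=
  mxcomp (phi_poly D (tnth w k) (mxline (delta_mx 0 1))) (q k)
    *m mxpolyC (weyl_rep D (tnth w k)).

Lemma mxhorner_braid_curve k a :
  mxhorner (braid_curve k) a = braid_mx D (tnth w k) (q k).[a].
Proof. by rewrite mxhornerM mxhornerC mxhorner_comp mxhorner_phi mxU_line. Qed.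

Lemma mxderiv_braid_curve k a : mxhorner (mxderiv (braid_curve k)) a =
  (q k)^`().[a] *: dbraid_mx D (tnth w k) (q k).[a].
Proof.
rewrite mxderivM mxderivC mulmx0 addr0 mxderiv_comp mxhornerM mxhornerC mxhornerZ.
by rewrite mxhorner_comp mxderiv_phi mxU_line mxderiv_line -scalemxAl.
Qed.

Definition curve_point a : l.-tuple C := [tuple (q k).[a] | k < l].

Lemma braid_curve_point a :
  (fun k => mxhorner (braid_curve k) a) = braid_point D w (curve_point a).
Proof. by apply/funext=> k; rewrite mxhorner_braid_curve /braid_point tnth_mktuple. Qed.

Lemma mxhorner_lprod_curve a :
  mxhorner (lprod braid_curve l) a = cell_mx w (curve_point a).
Proof. by rewrite mxhorner_lprod braid_curve_point. Qed.

Lemma mxderiv_lprod_curve a : mxhorner (mxderiv (lprod braid_curve l)) a =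
  \sum_k (q k)^`().[a] *: cell_tangent w (curve_point a) k.
Proof.
rewrite mxderiv_lprod /mxhorner raddf_sum; apply: eq_bigr => k _ /=.
rewrite -/(mxhorner _ _) mxhorner_insert_at braid_curve_point /cell_tangent /insert_at.
by rewrite mxderiv_braid_curve tnth_mktuple -scalemxAr -scalemxAl.
Qed.

End Curve.

Section ChangeOfWord.
Variables (l l' : nat) (w : l.-tuple I) (w' : l'.-tuple I) (F : l'.-tuple {mpoly C[l]}).
Hypothesis cell_mxF : forall z, cell_mx w z = cell_mx w' (poly_map F z).

(** The two product matrices agree along a whole coordinate line, hence as matrices of polynomials,
    and so do their derivatives. *)
Lemma cell_tangent_chain z c : cell_tangent w z c =
  \sum_a jacobian F z a c *: cell_tangent w' (poly_map F z) a.
Proof.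
(* The line through [z] in direction [c], and next its image under [F]. *)
pose q k : {poly C} := (tnth z k)%:P + (k == c)%:R *: 'X.
pose q' k := mmap polyC q (tnth F k).
have qz : curve_point q 0 = z.
  apply: eq_from_tnth => k; rewrite tnth_mktuple /q hornerD hornerC hornerZ hornerX.
  by rewrite mulr0 addr0.
have qF a : curve_point q' a = poly_map F (curve_point q a).
  apply: eq_from_tnth => k; rewrite !tnth_mktuple horner_mmap.
  by apply: meval_eq => m; rewrite tnth_mktuple.
have : lprod (braid_curve w q) l = lprod (braid_curve w' q') l'.
  by apply: mxhorner_inj => a; rewrite !mxhorner_lprod_curve qF.
move=> /(congr1 (fun A => mxhorner (mxderiv A) 0)); rewrite !mxderiv_lprod_curve qF qz.
have dq k : (q k)^`() = (k == c)%:R%:P.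
  by rewrite derivD derivC add0r derivZ derivX alg_polyC.
rewrite (bigD1 c) //= big1 => [|k nk]; last by rewrite dq (negPf nk) hornerC scale0r.
rewrite dq eqxx hornerC scale1r addr0 => ->; apply: eq_bigr => a _; congr (_ *: _).
rewrite deriv_mmap horner_sum (bigD1 c) //= big1 => [|k nk].
  rewrite addr0 dq eqxx hornerM hornerC mulr1 horner_mmap mxE; apply: meval_eq => m.
  by rewrite -[z in RHS]qz tnth_mktuple.
by rewrite dq (negPf nk) hornerM hornerC mulr0.
Qed.

End ChangeOfWord.

Section Poisson.
Variables (l : nat) (w : l.-tuple I) (P : l.-tuple C -> 'M[C]_l).
Hypothesis stP : is_standard_poisson D w P.

Definition annihilates_lie_bor (g xi : 'M[C]_n) : Prop :=
  forall y, lie_alg (bor D) y -> \tr (xi *m (g *m y)) = 0.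

(* Multiplication of the factors is a Poisson map from the cell to G / B. *)
Lemma standard_poisson_mult z xi eta :
  annihilates_lie_bor (cell_mx w z) xi -> annihilates_lie_bor (cell_mx w z) eta ->
  \sum_k \sum_m P z k m * \tr (xi *m cell_tangent w z k) * \tr (eta *m cell_tangent w z m)
  = pi_st D (cell_mx w z) xi eta.
Proof.
move=> Axi Aeta; case: stP => _ /(_ z (fun=> 1%:M)).
have actE p : bs_act p (fun=> 1%:M : 'M[C]_n) = p :> ('I_l -> 'M[C]_n).
  by apply/funext=> k; rewrite /bs_act /prev if_same invmx1 mulmx1 mul1mx.
have pairE zeta k : pairing (pullback (braid_point D w z) zeta)
    (lift_diff D w z (fun=> 1%:M) k) = \tr (zeta *m cell_tangent w z k).
  rewrite /pairing /lift_diff actE (bigD1 k) //= big1 => [|k' /negPf->].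
    by rewrite eqxx addr0 mxtrace_pullback.
  by rewrite mulmx0 mxtrace0.
have B1 : in_borels D (fun _ : 'I_l => 1%:M : 'M[C]_n).
  by case: (bor_subgroup hD) => _ B1 _ _ k; exact: B1.
move=> /(_ B1); rewrite /= actE.
move=> /(_ _ _ (pullback_conormal Axi) (pullback_conormal Aeta)).
rewrite pi_prod_pullback => <-.
by apply: eq_bigr => k _; apply: eq_bigr => m _; rewrite !pairE.
Qed.

End Poisson.

Definition independent_mod_bor l (v : 'I_l -> 'M[C]_n) : Prop :=
  forall c : 'I_l -> C, lie_alg (bor D) (\sum_a c a *: v a) -> forall a, c a = 0.

(** Covectors vanishing on the translate of Lie B separate vectors independent modulo it; this is
    used once for each argument of the form. *)
Lemma bilinear_form_eq0 l (v : 'I_l -> 'M[C]_n) (g : 'M[C]_n) (Q : 'M[C]_l) :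
  g \in unitmx -> independent_mod_bor (fun a => invmx g *m v a) ->
  (forall xi eta, annihilates_lie_bor g xi -> annihilates_lie_bor g eta ->
     \sum_k \sum_m Q k m * \tr (xi *m v k) * \tr (eta *m v m) = 0) ->
  Q = 0.
Proof.
move=> ug indep Q0.
have sep (c : 'I_l -> C) :
    (forall xi, annihilates_lie_bor g xi -> \sum_k c k * \tr (xi *m v k) = 0) ->
    forall k, c k = 0.
  move=> c0; apply: indep; apply: lie_alg_annihilator => xi Bxi.
  (* Right multiplication by [invmx g] turns a covector that kills Lie B at the identity into one
     that kills its left translate at [g]. *)
  rewrite mulmx_sumr raddf_sum /= -[RHS](c0 (xi *m invmx g)).
    by apply: eq_bigr => k _; rewrite -scalemxAr mxtraceZ mulmxA.
  by move=> y By; rewrite mulmxA mulmxKV // Bxi.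
apply/matrixP=> k m; rewrite mxE.
apply: (sep (fun m => Q k m)) => eta Aeta.
apply: (sep (fun k => \sum_m Q k m * \tr (eta *m v m))) => xi Axi.
rewrite -[RHS](Q0 xi eta Axi Aeta); apply: eq_bigr => k' _; rewrite mulr_suml.
by apply: eq_bigr => m' _; rewrite mulrAC.
Qed.

(** The Jacobian expresses the pairings with source tangents through those with target tangents, and
    both bivectors give [pi_st] at the common product matrix. Independence is therefore required at
    the target. *)
Lemma change_of_word_poisson l l' (w : l.-tuple I) (w' : l'.-tuple I)
    (F : l'.-tuple {mpoly C[l]}) P P' :
  (forall z, cell_mx w z = cell_mx w' (poly_map F z)) ->
  (forall z', independent_mod_bor (fun a => invmx (cell_mx w' z') *m cell_tangent w' z' a)) ->
  is_standard_poisson D w P -> is_standard_poisson D w' P' ->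
  forall z, jacobian F z *m P z *m (jacobian F z)^T = P' (poly_map F z).
Proof.
move=> mF indep stP stP' z; apply/eqP; rewrite -subr_eq0; apply/eqP.
apply: bilinear_form_eq0 (cell_mx_unit w' (poly_map F z)) (indep _) _ => xi eta Axi Aeta.
pose x a := \tr (xi *m cell_tangent w' (poly_map F z) a).
pose y a := \tr (eta *m cell_tangent w' (poly_map F z) a).
set J := jacobian F z.
have formE (r : nat) (Q : 'M[C]_r) (u v : 'I_r -> C) :
    \sum_k \sum_m Q k m * u k * v m = ((\row_k u k) *m Q *m (\col_m v m)) 0 0.
  rewrite mxE exchange_big; apply: eq_bigr => m _; rewrite !mxE mulr_suml.
  by apply: eq_bigr => k _; rewrite !mxE [u k * _]mulrC.
have xJ : (\row_k \tr (xi *m cell_tangent w z k)) = (\row_k x k) *m J.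
  apply/rowP=> k; rewrite !mxE (cell_tangent_chain mF) mulmx_sumr raddf_sum.
  by apply: eq_bigr => a _; rewrite /= -scalemxAr mxtraceZ !mxE mulrC.
have yJ : (\col_k \tr (eta *m cell_tangent w z k)) = J^T *m (\col_k y k).
  apply/colP=> k; rewrite !mxE (cell_tangent_chain mF) mulmx_sumr raddf_sum.
  by apply: eq_bigr => a _; rewrite /= -scalemxAr mxtraceZ !mxE.
have e : (\row_k x k *m P' (poly_map F z) *m \col_k y k) 0 0 =
    ((\row_k x k *m J) *m P z *m (J^T *m \col_k y k)) 0 0.
  rewrite -xJ -yJ -(formE _ (P z)) -(formE _ _ x y) (standard_poisson_mult stP' Axi Aeta).
  by rewrite -mF in Axi Aeta *; rewrite (standard_poisson_mult stP Axi Aeta).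
rewrite (formE _ _ x y) mulmxBr mulmxBl mxE [X in _ + X]mxE e !mulmxA subrr.
by [].
Qed.

End CellTangents.

(** * Injectivity of the charts and the two isomorphisms *)

Section Cells.
Variables (C : numClosedFieldType) (I : finType) (n : nat) (D : group_data C I n).
Hypothesis hD : is_pinned_simply_laced_group D.

(** Along the word, if the previous entry of [b] is trivial, then the next is B_i(z)^-1 B_i(z'), an
    element of y_i that lies in B; it is trivial and the coordinates agree. *)
Lemma Phi_inj l (w : l.-tuple I) :
  (forall k, exists j, tnth w k != j) -> injective (Phi D w).
Proof.
move=> nw z z' eqPhi.
have [b Bb zz'] : bs_class D (braid_point D w z) (braid_point D w z').
  rewrite -/(Phi D w z) eqPhi; exists (fun=> 1%:M).
    by case: (bor_subgroup hD) => _ B1 _ _ k; exact: B1.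
  by apply/funext=> k; rewrite /bs_act /prev if_same invmx1 mulmx1 mul1mx.
have step k : prev 1%:M b k = 1%:M -> b k = 1%:M /\ tnth z k = tnth z' k.
  move=> pk1; have := congr1 (fun q => q k) zz'.
  rewrite /bs_act pk1 invmx1 mul1mx /braid_point; set i := tnth w k => Bz'.
  have uS := weyl_unit hD i; have XE := xroot_one_param hD i.
  (* From x_i(-z) x_i(z') s_i = s_i y_i(z - z'). *)
  have bk : b k = yroot D i (tnth z k - tnth z' k).
    rewrite -[LHS](mulKmx (braid_unit hD i (tnth z k))) -Bz' /braid_mx.
    rewrite -/(xroot D i (tnth z k)) invmxM ?(one_param_unit XE) // (one_paramV XE).
    rewrite -mulmxA (mulmxA (xroot _ _ _)) -/(xroot D i (tnth z' k)).
    case: XE => _ [_ _ <- _]; rewrite (xroot_weyl hD) mulKmx //.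
    by rewrite opprD opprK.
  have [j nij] := nw k; have := Bb k; rewrite bk => /(yroot_borel hD nij) z0.
  split; last by apply/eqP; rewrite -subr_eq0 z0.
  by rewrite z0; case: (yroot_one_param hD i) => ? [].
suff rec m (k : 'I_l) : k = m :> nat -> b k = 1%:M.
  apply: eq_from_tnth => k; case: (step k) => //; rewrite /prev; case: eqP => // _.
  exact: rec.
elim: m k => [|m IH] k km; case: (step k) => //; rewrite /prev /= km //=.
apply: IH; rewrite /= km addSn /= modnDr modn_small //.
by rewrite -ltnS -km ltnW // ltnS ltn_ord.
Qed.

Lemma cell_poisson_iso l (w w' : l.-tuple I) (F : l.-tuple {mpoly C[l]}) P P' :
  injective (Phi D w) -> injective (Phi D w') ->
  involutive (@poly_map C l l F) ->
  (forall z, cell_mx D w z = cell_mx D w' (poly_map F z)) ->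
  (forall z', independent_mod_bor D
     (fun a => invmx (cell_mx D w' z') *m cell_tangent D w' z' a)) ->
  is_standard_poisson D w P -> is_standard_poisson D w' P' ->
  exists2 psi, forall z, psi (Phi D w z) = Phi D w' (poly_map F z) &
    is_poisson_iso D w w' P P' psi.
Proof.
move=> Pinj Pinj' FK mF indep stP stP'.
(* Coordinates of a class are chosen by [xget]; injectivity makes them unique on the cell, and the
   zero tuple is the default off it. *)
pose psi X := Phi D w' (poly_map F (xget [tuple 0 | _ < l] [set z | Phi D w z = X])).
have psiE z : psi (Phi D w z) = Phi D w' (poly_map F z).
  congr (Phi D w' (poly_map F _)); apply: xget_unique => // z'; exact: Pinj.
exists psi => //; split.
  split=> [_ [z _ <-]|X Y|_ [z _ <-]]; first by rewrite psiE; exists (poly_map F z).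
    rewrite !inE => -[z _ <-] [z' _ <-]; rewrite !psiE => /Pinj'.
    by move/(can_inj FK) ->.
  by exists (Phi D w (poly_map F z)); [exists (poly_map F z)|rewrite psiE FK].
exists F, F; split=> // [z'|]; first by rewrite psiE FK.
exact (change_of_word_poisson hD mF indep stP stP').
Qed.

Local Notation o2 k := (@Ordinal 2 k isT).
Local Notation o3 k := (@Ordinal 3 k isT).

Definition swap2 : 2.-tuple {mpoly C[2]} := [tuple 'X_(o2 1); 'X_(o2 0)].

Lemma poly_map_swap2 z1 z2 : poly_map swap2 [tuple z1; z2] = [tuple z2; z1].
Proof.
by apply: eq_from_tnth => -[[|[|//]] ?]; rewrite tnth_mktuple /= mevalXU.
Qed.

Definition braid3 : 3.-tuple {mpoly C[3]} :=
  [tuple 'X_(o3 2); 'X_(o3 0) * 'X_(o3 2) - 'X_(o3 1); 'X_(o3 0)].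

Lemma poly_map_braid3 z1 z2 z3 :
  poly_map braid3 [tuple z1; z2; z3] = [tuple z3; z1 * z3 - z2; z1].
Proof.
apply: eq_from_tnth => -[[|[|[|//]]] ?]; rewrite tnth_mktuple /= ?mevalXU //.
by rewrite mevalB mevalM !mevalXU.
Qed.

Lemma tuple2P (z : 2.-tuple C) : exists z1 z2, z = [tuple z1; z2].
Proof.
exists (tnth z (o2 0)), (tnth z (o2 1)); apply: eq_from_tnth => -[[|[|//]] ?];
  by congr (tnth z _); apply: val_inj.
Qed.

Lemma tuple3P (z : 3.-tuple C) : exists z1 z2 z3, z = [tuple z1; z2; z3].
Proof.
exists (tnth z (o3 0)), (tnth z (o3 1)), (tnth z (o3 2)).
by apply: eq_from_tnth => -[[|[|[|//]]] ?]; congr (tnth z _); apply: val_inj.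
Qed.

Lemma cell_mx2 i j z1 z2 : cell_mx D [tuple i; j] [tuple z1; z2] =
  braid_mx D i z1 *m braid_mx D j z2.
Proof. by rewrite /cell_mx lprodE !big_ord_recl big_ord0 [_ * 1]mulr1. Qed.

Lemma cell_mx3 i j k z1 z2 z3 : cell_mx D [tuple i; j; k] [tuple z1; z2; z3] =
  braid_mx D i z1 *m braid_mx D j z2 *m braid_mx D k z3.
Proof. by rewrite /cell_mx lprodE !big_ord_recl big_ord0 [_ * 1]mulr1 -mulmxA. Qed.

Lemma independent2 i j z : non_adjacent D i j -> independent_mod_bor D
  (fun a => invmx (cell_mx D [tuple i; j] z) *m cell_tangent D [tuple i; j] z a).
Proof.
move=> na c; have [/eqP nij _ _] := na; have nji : j != i by rewrite eq_sym.
set w := [tuple i; j]; set p := braid_point D w z.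
have R2 : rprod p 2 = 1%:M := rprod_size p.
have R1 : rprod p 1 = braid_mx D j (tnth z (o2 1)).
  by apply: etrans (rprodS p (o2 1)) _; rewrite -[RHS]mulmx1 -R2.
have adj1 (x : 'M[C]_n) : adj (invmx 1%:M) x = x.
  by rewrite /adj !invmx1 mulmx1 mul1mx.
rewrite (eq_bigr (fun a : 'I_2 => - (c a *: adj (invmx (rprod p a.+1)) (froot D (tnth w a)))));
  last by move=> a _; rewrite (cell_tangent_left hD) scalerN.
rewrite sumrN => /lie_algN; rewrite opprK !big_ord_recl big_ord0 addr0.
rewrite [rprod p _ in X in _ + X]R2 adj1 [rprod p _ in X in X + _]R1.
rewrite (adj_invbraid_froot hD _ nji).
(* Ad(s_j) fixes F_i, hence so does its inverse, and the tangents reduce to F_i and F_j. *)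
rewrite -{1}(adj_weyl_F_non_adjacent hD (non_adjacentC na)) adjK ?(weyl_unit hD) //.
move=> /(non_adjacent_tangents hD na)[c0 c1] a.
by case: a => -[|[|//]] lt2; [rewrite -[RHS]c0|rewrite -[RHS]c1];
  congr (c _); apply: val_inj.
Qed.

Lemma independent3 i j z : adjacent D i j -> independent_mod_bor D
  (fun a => invmx (cell_mx D [tuple i; j; i] z) *m cell_tangent D [tuple i; j; i] z a).
Proof.
move=> ad c; set w := [tuple i; j; i]; set p := braid_point D w z.
have R3 : rprod p 3 = 1%:M := rprod_size p.
have R2 : rprod p 2 = braid_mx D i (tnth z (o3 2)).
  by apply: etrans (rprodS p (o3 2)) _; rewrite -[RHS]mulmx1 -R3.
have R1 : rprod p 1 = braid_mx D j (tnth z (o3 1)) *m braid_mx D i (tnth z (o3 2)).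
  by apply: etrans (rprodS p (o3 1)) _; rewrite -R2.
have adj1 (x : 'M[C]_n) : adj (invmx 1%:M) x = x.
  by rewrite /adj !invmx1 mulmx1 mul1mx.
rewrite (eq_bigr (fun a : 'I_3 => - (c a *: adj (invmx (rprod p a.+1)) (froot D (tnth w a)))));
  last by move=> a _; rewrite (cell_tangent_left hD) scalerN.
rewrite sumrN => /lie_algN; rewrite opprK !big_ord_recl big_ord0 addr0.
rewrite [rprod p _ in X in _ + (_ + X)]R3 adj1.
rewrite [rprod p _ in X in _ + (X + _)]R2 [rprod p _ in X in X + _]R1.
rewrite invmxM ?(braid_unit hD) // -adj_comp ?unitmx_inv ?(braid_unit hD) // addrA.
move=> /(adjacent_tangents hD ad)[c0 c1 c2] a.
by case: a => -[|[|[|//]]] lt3; [rewrite -[RHS]c0|rewrite -[RHS]c1|rewrite -[RHS]c2];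
  congr (c _); apply: val_inj.
Qed.

Lemma tetravalent_poisson_iso i k P P' : non_adjacent D i k ->
  is_standard_poisson D [tuple i; k] P -> is_standard_poisson D [tuple k; i] P' ->
  exists psi, (forall z1 z2,
    psi (Phi D [tuple i; k] [tuple z1; z2]) = Phi D [tuple k; i] [tuple z2; z1]) /\
    is_poisson_iso D [tuple i; k] [tuple k; i] P P' psi.
Proof.
move=> na stP stP'; have [/eqP nik _ _] := na.
have inj i' k' : i' != k' -> injective (Phi D [tuple i'; k']).
  move=> nik'; apply: Phi_inj => -[[|[|//]] ?]; [exists k'|exists i'] => //.
  by rewrite eq_sym.
have FK : involutive (@poly_map C 2 2 swap2).
  by move=> z; have [z1 [z2 ->]] := tuple2P z; rewrite !poly_map_swap2.
have mF z : cell_mx D [tuple i; k] z = cell_mx D [tuple k; i] (poly_map swap2 z).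
  have [z1 [z2 ->]] := tuple2P z; rewrite poly_map_swap2 !cell_mx2.
  exact (braid_mx_comm hD z1 z2 na).
have nki : k != i by rewrite eq_sym.
(* Independence concerns the target word, so the two letters are exchanged. *)
have [psi psiE iso] := cell_poisson_iso (inj _ _ nik) (inj _ _ nki) FK mF
  (fun z => independent2 (z := z) (non_adjacentC na)) stP stP'.
by exists psi; split=> // z1 z2; rewrite psiE poly_map_swap2.
Qed.

Lemma hexavalent_poisson_iso i j P P' : adjacent D i j ->
  is_standard_poisson D [tuple i; j; i] P -> is_standard_poisson D [tuple j; i; j] P' ->
  exists psi, (forall z1 z2 z3,
    psi (Phi D [tuple i; j; i] [tuple z1; z2; z3]) =
    Phi D [tuple j; i; j] [tuple z3; z1 * z3 - z2; z1]) /\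
    is_poisson_iso D [tuple i; j; i] [tuple j; i; j] P P' psi.
Proof.
move=> ad stP stP'; have [/eqP nij _ _] := ad.
have inj i' j' : i' != j' -> injective (Phi D [tuple i'; j'; i']).
  move=> nij'; apply: Phi_inj => -[[|[|[|//]]] ?]; [exists j'|exists i'|exists j'] => //.
  by rewrite eq_sym.
have FK : involutive (@poly_map C 3 3 braid3).
  move=> z; have [z1 [z2 [z3 ->]]] := tuple3P z; rewrite !poly_map_braid3.
  (* Applied twice, the middle coordinate is z1 z3 - (z1 z3 - z2) = z2. *)
  by rewrite [z3 * z1]mulrC subKr.
have mF z : cell_mx D [tuple i; j; i] z = cell_mx D [tuple j; i; j] (poly_map braid3 z).
  have [z1 [z2 [z3 ->]]] := tuple3P z; rewrite poly_map_braid3 !cell_mx3.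
  exact (braid_relation hD z1 z2 z3 ad).
have nji : j != i by rewrite eq_sym.
have [psi psiE iso] := cell_poisson_iso (inj _ _ nij) (inj _ _ nji) FK mF
  (fun z => independent3 (z := z) (adjacentC ad)) stP stP'.
by exists psi; split=> // z1 z2 z3; rewrite psiE poly_map_braid3.
Qed.

End Cells.

Local Open Scope complex_scope.

Theorem proposition4p6 (R : realType) (I : finType) (n : nat)
    (D : group_data R[i] I n) (hD : is_pinned_simply_laced_group D) :
  (forall (i k : I), non_adjacent D i k ->
    forall (P : 2.-tuple R[i] -> 'M[R[i]]_2) (P' : 2.-tuple R[i] -> 'M[R[i]]_2),
      is_standard_poisson D [tuple i; k] P ->
      is_standard_poisson D [tuple k; i] P' ->
      exists psi : set ('I_2 -> 'M[R[i]]_n) -> set ('I_2 -> 'M[R[i]]_n),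
        (forall z1 z2 : R[i],
           psi (Phi D [tuple i; k] [tuple z1; z2])
           = Phi D [tuple k; i] [tuple z2; z1]) /\
        is_poisson_iso D [tuple i; k] [tuple k; i] P P' psi) /\
  (forall (i j : I), adjacent D i j ->
    forall (P : 3.-tuple R[i] -> 'M[R[i]]_3) (P' : 3.-tuple R[i] -> 'M[R[i]]_3),
      is_standard_poisson D [tuple i; j; i] P ->
      is_standard_poisson D [tuple j; i; j] P' ->
      exists psi : set ('I_3 -> 'M[R[i]]_n) -> set ('I_3 -> 'M[R[i]]_n),
        (forall z1 z2 z3 : R[i],
           psi (Phi D [tuple i; j; i] [tuple z1; z2; z3])
           = Phi D [tuple j; i; j] [tuple z3; z1 * z3 - z2; z1]) /\
        is_poisson_iso D [tuple i; j; i] [tuple j; i; j] P P' psi).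
Proof.
split=> [i k na|i j ad] P P' stP stP'; last exact (hexavalent_poisson_iso hD ad stP stP').
exact (tetravalent_poisson_iso hD na stP stP').
Qed.
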